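(* Let $P_0,P_1$ be probability measures on a measurable space $(\mathcal X,\mathcal B_{\mathcal X})$ with $P_1\ll P_0$ and $\mathrm{KL}(P_1\|P_0)<\infty$, and work in the i.i.d. model they generate. Let $\mathcal W$ be the class of all betting sequences for $\mathbb P_0$, and $\mathcal W_{\mathrm{iid}}\subseteq\mathcal W$ the subclass of those of the form $E_n=E(X_n)$, $n\in\mathbb N$, for a single $E\in\mathcal E$. Then for every $t\in\mathbb N$, $$\sup_{\mathcal W}\Lambda^{(t)}\ =\ \sup_{\mathcal W_{\mathrm{iid}}}\Lambda^{(t)}\ =\ \sup_{E\in\mathcal E}\Lambda(E)\ =\ \mathrm{KL}(P_0\|P_1),$$ the common value being approached along the family $(R_\beta)_{\beta\in(0,1]}$ as $\beta\downarrow0$ (i.e. $\Lambda(R_\beta)\to\mathrm{KL}(P_0\|P_1)$). If moreover $P_0$ and $P_1$ are mutually absolutely continuous, $\mathrm{KL}(P_0\|P_1)<\infty$, and $\log R$ is not $P_0$-a.s. constant, then no member of $\mathcal W$ attains it (i.e. $\Lambda^{(t)}<\mathrm{KL}(P_0\|P_1)$ for every betting sequence and every $t\in\mathbb N$). Consequently, for every betting sequence, every $\alpha\in(0,1)$ with $\ell=\log\frac1\alpha$, and every $t\in\mathbb N$, $$\bar\gamma_t(\alpha)\le\gamma_t(\alpha)\le\exp\big(s\ell-t\Lambda^{(t)}_s\big)\quad\text{for all }s\ge0,$$ and no betting sequence makes $\Lambda^{(t)}_s$ exceed $\mathrm{KL}(P_0\|P_1)$, for any $s\ge0$ and any $t$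.
   Context: I.i.d. model: $\Omega=\mathcal X^{\mathbb N}$ with product $\sigma$-algebra, coordinates $X_n$, $\mathcal F_t=\sigma(X_1,\dots,X_t)$ ($\mathcal F_0$ trivial), $\mathbb P_i=P_i^{\otimes\mathbb N}$. $\mathrm{KL}(Q\|P)=\mathbb E_Q[\log\frac{dQ}{dP}]$ if $Q\ll P$, $+\infty$ otherwise. $R:=\frac{dP_1}{dP_0}$; for $\beta\in(0,1]$, $Z_\beta:=\mathbb E_{P_0}[R^\beta]$ and $R_\beta:=R^\beta/Z_\beta$. $\mathcal E$ is the set of measurable $E:\mathcal X\to[0,\infty]$ with $\mathbb E_{P_0}[E]\le1$; $\Lambda(E):=\sup_{s\ge0}\{-\log\mathbb E_{P_1}[E^{-s}]\}$. A betting sequence is a sequence $(E_t)_{t\in\mathbb N}$ of $\mathcal F_t$-measurable $E_t:\Omega\to[0,\infty]$ with $\mathbb E_{\mathbb P_0}[E_t\mid\mathcal F_{t-1}]\le1$ $\mathbb P_0$-a.s.; wealth $W_0=1$, $W_t=\prod_{n\le t}E_n$; $\Lambda^{(t)}_s:=-\frac1t\log\mathbb E_{\mathbb P_1}[W_t^{-s}]$, $\Lambda^{(t)}:=\sup_{s\ge0}\Lambda^{(t)}_s$. $\tau_\alpha:=\inf\{t\in\mathbb N:W_t>\frac1\alpha\}$, $\gamma_t(\alpha):=\mathbb P_1(W_t\le\frac1\alpha)$, $\bar\gamma_t(\alpha):=\mathbb P_1(\tau_\alpha>t)$. Conventions: $x^0=1$; for $s>0$, $0^{-s}=+\infty$,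 $(+\infty)^{-s}=0$; $0\cdot\infty=0$; $\log(+\infty)=+\infty$, $e^{+\infty}=+\infty$. *)

(* Defs.v *)
From HB Require Import structures.
From mathcomp Require Import all_boot all_order all_algebra.
From mathcomp Require Import all_classical all_reals all_analysis.
From mathcomp Require Import measurable_realfun.
Import Order.TTheory GRing.Theory Num.Theory.
Import numFieldNormedType.Exports.

Set Implicit Arguments.
Unset Strict Implicit.
Unset Printing Implicit Defensive.

Local Open Scope classical_set_scope.
Local Open Scope ring_scope.
Local Open Scope ereal_scope.

(* For Q `<< P the library function Radon_Nikodym_SigmaFinite.f Q P is a version
   of dQ/dP that is nonnegative and finite at every point. *)
Definition density d (X : measurableType d) (R : realType)
    (Q P : probability X R) : X -> \bar R :=
  Radon_Nikodym_SigmaFinite.f Q P.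

Definition KL d (X : measurableType d) (R : realType)
    (Q P : probability X R) : \bar R :=
  if `[< Q `<< P >] then \int[Q]_x lne (density Q P x) else +oo.

(* E^{-s} is rendered as the extended-real inverse of E `^ s, which for E in
   [0, +oo] and s >= 0 gives x^0 = 1 and, for s > 0, 0^{-s} = +oo and
   (+oo)^{-s} = 0; moreover lne 0 = -oo and lne +oo = +oo. *)
Definition neg_log_moment d (T : measurableType d) (R : realType)
    (P : probability T R) (E : T -> \bar R) (s : R) : \bar R :=
  - lne (\int[P]_x (E x `^ s)^-1).

Definition evariables d (X : measurableType d) (R : realType)
    (P0 : probability X R) : set (X -> \bar R) :=
  [set E : X -> \bar R | [/\ measurable_fun [set: X] E, forall x, 0 <= E x
             & \int[P0]_x E x <= 1]].

Definition Lambda d (X : measurableType d) (R : realType)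
    (P1 : probability X R) (E : X -> \bar R) : \bar R :=
  ereal_sup [set neg_log_moment P1 E s | s in [set s | (0 <= s)%R]].

Definition Zbeta d (X : measurableType d) (R : realType)
    (P0 P1 : probability X R) (beta : R) : \bar R :=
  \int[P0]_x (density P1 P0 x `^ beta).

Definition Rbeta d (X : measurableType d) (R : realType)
    (P0 P1 : probability X R) (beta : R) : X -> \bar R :=
  fun x => density P1 P0 x `^ beta / Zbeta P0 P1 beta.

(* Coordinates are numbered from 0: for w in the sequence space, w k is the
   observation X_(k+1) of the one-based notation. *)
Definition coord_sets d (X : measurableType d) : set (set (nat -> X)) :=
  \bigcup_k preimage_set_system setT (fun w : nat -> X => w k) measurable.

(* X^N with the product sigma-algebra. *)
Notation seq_space X := (g_sigma_algebraType (@coord_sets _ X)).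

(* The product measure P^{(x)N}: by the pi-lambda theorem, this property
   determines PP uniquely. *)
Definition is_iid_law d (X : measurableType d) (R : realType)
    (P : probability X R) (PP : probability (seq_space X) R) : Prop :=
  forall (n : nat) (A : nat -> set X), (forall k, measurable (A k)) ->
    PP [set w | forall k, (k < n)%N -> A k (w k)] = \prod_(k < n) P (A k).

(* F_n, generated by the first n coordinates; F_0 is trivial. *)
Definition filt d (X : measurableType d) (n : nat) : set (set (seq_space X)) :=
  g_sigma_preimage (fun (k : 'I_n) (w : nat -> X) => w k).

Definition measurable_wrt (T : pointedType) (R : realType)
    (G : set (set T)) (f : T -> \bar R) : Prop :=
  measurable_fun [set: g_sigma_algebraType G] f.

(* Z is a version of E_P[Y | G], for Y valued in [0, +oo] (Y need not be
   integrable) and a sub-sigma-algebra G. *)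
Definition is_cond_exp d (T : measurableType d) (R : realType)
    (P : probability T R) (G : set (set T)) (Y Z : T -> \bar R) : Prop :=
  [/\ measurable_wrt G Z, forall w, 0 <= Z w
    & forall A, G A -> \int[P]_(w in A) Z w = \int[P]_(w in A) Y w].

(* B n is the bet E_(n+1) placed on the observation X_(n+1) = w n. *)
Definition betting d (X : measurableType d) (R : realType)
    (PP0 : probability (seq_space X) R) :
    set (nat -> seq_space X -> \bar R) :=
  [set B : nat -> seq_space X -> \bar R | forall n,
    [/\ measurable_wrt (@filt _ X n.+1) (B n), forall w, 0 <= B n w
      & exists Z, is_cond_exp PP0 (@filt _ X n) (B n) Z
                  /\ {ae PP0, forall w, Z w <= 1}]].

Definition betting_iid d (X : measurableType d) (R : realType)
    (P0 : probability X R) (PP0 : probability (seq_space X) R) :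
    set (nat -> seq_space X -> \bar R) :=
  [set B : nat -> seq_space X -> \bar R | betting PP0 B /\
    exists2 E, evariables P0 E & forall n (w : seq_space X), B n w = E (w n)].

Definition wealth d (X : measurableType d) (R : realType)
    (B : nat -> seq_space X -> \bar R) (t : nat) (w : seq_space X) : \bar R :=
  \prod_(n < t) B n w.

Definition Lambda_ts d (X : measurableType d) (R : realType)
    (PP1 : probability (seq_space X) R) (B : nat -> seq_space X -> \bar R)
    (t : nat) (s : R) : \bar R :=
  (t%:R^-1)%:E * neg_log_moment PP1 (wealth B t) s.

Definition Lambda_t d (X : measurableType d) (R : realType)
    (PP1 : probability (seq_space X) R) (B : nat -> seq_space X -> \bar R)
    (t : nat) : \bar R :=
  ereal_sup [set Lambda_ts PP1 B t s | s in [set s | (0 <= s)%R]].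

(* +oo if the wealth never exceeds 1/alpha. *)
Definition tau d (X : measurableType d) (R : realType)
    (B : nat -> seq_space X -> \bar R) (alpha : R) (w : seq_space X) : \bar R :=
  ereal_inf [set (t%:R)%:E | t in
    [set t : nat | (0 < t)%N /\ (alpha^-1)%:E < wealth B t w]].

Definition gamma_t d (X : measurableType d) (R : realType)
    (PP1 : probability (seq_space X) R) (B : nat -> seq_space X -> \bar R)
    (t : nat) (alpha : R) : \bar R :=
  PP1 [set w | wealth B t w <= (alpha^-1)%:E].

Definition gammabar_t d (X : measurableType d) (R : realType)
    (PP1 : probability (seq_space X) R) (B : nat -> seq_space X -> \bar R)
    (t : nat) (alpha : R) : \bar R :=
  PP1 [set w | (t%:R)%:E < tau B alpha w].

(* Main.v *)
Require Import Defs.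
From HB Require Import structures.
From mathcomp Require Import all_boot all_order all_algebra.
From mathcomp Require Import all_classical all_reals all_analysis.
From mathcomp Require Import measurable_realfun.
From mathcomp Require Import ring lra.
Import Order.TTheory GRing.Theory Num.Theory.
Import numFieldNormedType.Exports.

Set Implicit Arguments.
Unset Strict Implicit.
Unset Printing Implicit Defensive.

Local Open Scope classical_set_scope.
Local Open Scope ring_scope.
Local Open Scope ereal_scope.

(* For s >= 0 put b = 1/(1+s) and let R_t be the likelihood ratio of t
   observations. Holder's inequality with exponents 1/b and 1/(1-b), applied to
   R_t^b = (W^{-s} R_t)^b W^{1-b}, together with the supermartingale bound
   E_{P0}[W] <= 1, gives E_{P1}[W^{-s}] >= E_{P0}[R^b]^{t/b} for the wealth W of
   any betting sequence. Hence Lambda_s^{(t)} is at most the Renyi divergence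
   D_b := -(1/b) log E_{P0}[R^b], which R_b attains at s = (1-b)/b. By Jensen's
   inequality D_b <= KL(P0||P1), strictly unless R is constant, and D_b increases
   to KL(P0||P1) as b decreases to 0 by monotone convergence.
   For non-attainment, s in a bounded range is controlled by a single D_b, while
   for large s one has E_{P1}[W^{-s}] >= 1: either W < 1 with positive
   P1-probability and W^{-s} blows up there, or W >= 1 almost surely, and then
   E_{P0}[W] <= 1 forces W = 1. *)

(** * Integrals transported along maps *)

(** Wealth takes values in [[0, +oo]], moments and [KL P0 P1] may be [+oo], and conditional
    expectations are known only through integrals over sets of the filtration. The integral
    identities are therefore arranged between sums of nonnegative terms, and one transfer principle,
    from set integrals to integrals of nonnegative functions, serves for independence, for the
    likelihood ratio and for the supermartingale step. Holder's inequality enters through its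
    pointwise source, weighted AM-GM with a free constant [c], normalised so that [(c * R_t) ^ b]
    has mean 1. The gap in Jensen's inequality is computed exactly: up to the factor [1/b] it is the
    integral of [y - 1 - ln y] at the normalised power of [R], which yields the bound and its
    equality case together. Strictness for each [s] would not survive the supremum over [s]: as [s]
    grows, [b] tends to 0 and the bound tends to [KL P0 P1]. This is why large [s] needs a separate
    argument. *)

Section integral_transfer.
Import HBNNSimple.

(** Multiplication by [+oo] is discontinuous at 0; monotonicity removes the difficulty, since either
    all [a n] vanish or they are positive from some index on. *)
Lemma cvg_mule_ge0_nd (R : realType) (a : nat -> \bar R) (l u : \bar R) :
  (forall n, 0 <= a n) -> nondecreasing_seq a -> 0 <= u ->
  a n @[n --> \oo] --> l -> a n * u @[n --> \oo] --> l * u.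
Proof.
move=> a0 nda u0 al.
have l0 : 0 <= l by apply: (cvge_ge _ al); exact: nearW.
case: u u0 => [u| |] // u0; first by apply: cvgeZr.
have al' n : a n <= l.
  by apply: (cvge_ge _ al); exists n => // m /= nm; exact: nda.
have [l00|lneq0] := eqVneq l 0.
  have an0 n : a n = 0 by apply: le_anti; rewrite a0 andbT -l00.
  by under eq_fun do rewrite an0 mul0e; rewrite l00 mul0e; exact: cvg_cst.
have lgt0 : 0 < l by rewrite lt0e lneq0.
rewrite gt0_muley//.
have [N aN] : exists N, 0 < a N.
  apply: contrapT => /forallNP h.
  suff : l <= 0 by rewrite leNgt lgt0.
  by apply: (cvge_le _ al); apply: nearW => n; rewrite leNgt; apply/negP.
apply: cvg_near_cst; exists N => // n /= Nn.
by rewrite gt0_muley// (lt_le_trans aN)// nda.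
Qed.

(** The right-hand side sees [mu], [p] and [u] only through integrals of [u] over preimages under
    [p], while the approximation [h] depends on [W] alone; two such triples can then be compared. *)
Lemma integral_comp_mul_approx d1 d (T1 : measurableType d1)
    (T : measurableType d) (R : realType)
    (mu : {measure set T1 -> \bar R}) (p : T1 -> T) (u : T1 -> \bar R)
    (W : T -> \bar R) (mW : measurable_fun setT W) :
  measurable_fun setT p -> measurable_fun setT u -> (forall x, 0 <= u x) ->
  (forall x, 0 <= W x) ->
  \int[mu]_x (W (p x) * u x) =
  limn (fun n => let h := nnsfun_approx measurableT mW n in
    \sum_(y \in range h)
      (y%:E * \int[mu]_(x in p @^-1` (h @^-1` [set y])) u x)).
Proof.
move=> mp mu0 u0 W0.
pose h := nnsfun_approx measurableT mW.
have mh n : measurable_fun setT (h n \o p).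
  by apply: measurableT_comp.
have hcvg x : (EFin (h n x)) @[n --> \oo] --> W x.
  exact: cvg_nnsfun_approx.
have -> : \int[mu]_x (W (p x) * u x) =
    \int[mu]_x limn (fun n => (h n (p x))%:E * u x).
  apply: eq_integral => x _; apply/esym/cvg_lim => //.
  apply: cvg_mule_ge0_nd => //.
  - by move=> n; rewrite lee_fin.
  - by move=> m n mn; rewrite lee_fin; exact/lefP/nd_nnsfun_approx.
rewrite monotone_convergence//; last 3 first.
- move=> n; apply: emeasurable_funM => //.
  exact/measurable_EFinP/mh.
- by move=> n x _; rewrite mule_ge0// lee_fin.
- move=> x _ m n mn; rewrite lee_wpmul2r// lee_fin.
  exact/lefP/nd_nnsfun_approx.
congr (limn _); apply/funext => n /=; rewrite -/(h n).
have mE r : measurable (p @^-1` (h n @^-1` [set r])).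
  by rewrite -[X in measurable X]setTI; apply: mp.
transitivity (\int[mu]_x (\sum_(y \in range (h n))
    (y * \1_(h n @^-1` [set y]) (p x))%:E * u x)).
  apply: eq_integral => x xE.
  rewrite -ge0_mule_fsuml => [|y]; last exact: nnfun_muleindic_ge0.
  by rewrite fsumEFin // -(fimfunE _ (p x)).
rewrite ge0_integral_fsum//; last 2 first.
  - move=> y; apply: emeasurable_funM => //.
    apply/measurable_EFinP; apply: measurable_funM => //.
    exact: (measurable_indic (mE y)).
  - by move=> m y Ey; rewrite mule_ge0// nnfun_muleindic_ge0.
apply: eq_fsbigr => r; rewrite inE => -[t _ rE].
have r0 : (0 <= r)%R by rewrite -rE.
transitivity (\int[mu]_x (r%:E * (u \_ (p @^-1` (h n @^-1` [set r]))) x)).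
  apply: eq_integral => x _.
  by rewrite EFinM -muleA; congr (_ * _); rewrite epatch_indic muleC.
rewrite ge0_integralZl//.
- by rewrite -integral_mkcond.
- by apply/(measurable_restrictT _ (mE r)).1; exact: measurable_funTS.
- by move=> x _; rewrite patchE; case: ifP.
Qed.

(** Both maps may be the identity into a coarser sigma-algebra: agreement on its sets then extends
    to every nonnegative [W] measurable for it, which is how factors are pulled out of conditional
    expectations. *)
Lemma integral_transfer d1 d2 d (T1 : measurableType d1)
    (T2 : measurableType d2) (T : measurableType d) (R : realType)
    (mu1 : {measure set T1 -> \bar R}) (mu2 : {measure set T2 -> \bar R})
    (p1 : T1 -> T) (p2 : T2 -> T)
    (u1 : T1 -> \bar R) (u2 : T2 -> \bar R) (W : T -> \bar R) :
  measurable_fun setT p1 -> measurable_fun setT p2 ->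
  measurable_fun setT u1 -> measurable_fun setT u2 ->
  (forall x, 0 <= u1 x) -> (forall x, 0 <= u2 x) ->
  (forall A, measurable A ->
    \int[mu1]_(x in p1 @^-1` A) u1 x = \int[mu2]_(x in p2 @^-1` A) u2 x) ->
  measurable_fun setT W -> (forall x, 0 <= W x) ->
  \int[mu1]_x (W (p1 x) * u1 x) = \int[mu2]_x (W (p2 x) * u2 x).
Proof.
move=> mp1 mp2 mu10 mu20 u10 u20 h mW W0.
rewrite (integral_comp_mul_approx mu1 mW)// (integral_comp_mul_approx mu2 mW)//.
congr (limn _); apply/funext => n /=.
by apply: eq_fsbigr => r _; rewrite h.
Qed.

End integral_transfer.

Lemma integral_cst_probability d (T : measurableType d) (R : realType)
    (P : probability T R) (c : \bar R) : \int[P]_x c = c.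
Proof.
have P1 : P setT = 1 by exact: probability_setT.
by rewrite -[RHS]mule1 -P1; exact: (integral_cst P measurableT c).
Qed.

(** * Coordinates and product laws *)

Lemma emeasurable_prod_ord d (T : measurableType d) (R : realType) (D : set T)
    n (f : nat -> T -> \bar R) :
  (forall k, (k < n)%N -> measurable_fun D (f k)) ->
  measurable_fun D (fun x => \prod_(k < n) f k x).
Proof.
elim: n => [|n IH] mf; first by under eq_fun do rewrite big_ord0;
  exact: measurable_cst.
under eq_fun do rewrite big_ord_recr /=.
apply: emeasurable_funM; last exact: mf.
by apply: IH => k kn; apply: mf; exact: ltnW.
Qed.

Section coordinates.
Context d (X : measurableType d).
Implicit Types (n k : nat) (A : nat -> set X).

Definition cylinder n A : set (seq_space X) :=
  [set w | forall k, (k < n)%N -> A k (w k)].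

Lemma measurable_coord k :
  measurable_fun [set: seq_space X] (fun w : seq_space X => (w : nat -> X) k).
Proof.
move=> _ Y mY; rewrite setTI; apply: sub_sigma_algebra.
by exists k => //; exists Y => //; rewrite setTI.
Qed.

Lemma filt_coord n k B : (k < n)%N -> measurable B ->
  @filt _ X n [set w | B (w k)].
Proof.
move=> kn mB; apply: sub_sigma_algebra.
by rewrite (bigD1 (Ordinal kn))//=; left; exists B => //; rewrite setTI.
Qed.

Lemma filt_sub n (G : set (set (seq_space X))) : sigma_algebra setT G ->
  (forall k B, (k < n)%N -> measurable B -> G [set w | B (w k)]) ->
  @filt _ X n `<=` G.
Proof.
move=> sG h; apply: smallest_sub => //.
elim/big_ind : _ => [//|U V UG VG C [/UG//|/VG//]|i _ _ [B mB <-]].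
by rewrite setTI; apply: h.
Qed.

Lemma filt_sigma_algebra n : sigma_algebra setT (@filt _ X n).
Proof. exact: smallest_sigma_algebra. Qed.

(** [measurable_wrt] generates a sigma-algebra from [filt], which already is one; generating again
    adds nothing. *)
Lemma measurable_filt n (C : set (seq_space X)) :
  @measurable _ (g_sigma_algebraType (@filt _ X n)) C = @filt _ X n C.
Proof.
apply/propext; split=> [|h]; last exact: sub_sigma_algebra.
by apply: smallest_sub => //; exact: filt_sigma_algebra.
Qed.

Lemma filt_measurable n : @filt _ X n `<=` @measurable _ (seq_space X).
Proof.
apply: filt_sub => [|k B _ mB]; first exact: smallest_sigma_algebra.
by rewrite -[X in measurable X]setTI; exact: measurable_coord.
Qed.

Lemma filt_mono m n : (m <= n)%N -> @filt _ X m `<=` @filt _ X n.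
Proof.
move=> mn; apply: filt_sub => [|k B km mB]; first exact: filt_sigma_algebra.
by apply: filt_coord => //; exact: leq_trans mn.
Qed.

Lemma measurable_wrt_mono (R : realType) m n (f : seq_space X -> \bar R) :
  (m <= n)%N -> measurable_wrt (@filt _ X m) f -> measurable_wrt (@filt _ X n) f.
Proof.
move=> mn mf mT Y mY; rewrite measurable_filt; apply: (filt_mono mn).
by rewrite -measurable_filt; apply: mf => //.
Qed.

Lemma measurable_wrt_measurable (R : realType) n (f : seq_space X -> \bar R) :
  measurable_wrt (@filt _ X n) f -> measurable_fun [set: seq_space X] f.
Proof.
move=> mf mT Y mY; apply: (@filt_measurable n).
by rewrite -measurable_filt; apply: mf => //.
Qed.

Lemma measurable_wrt_coord n k : (k < n)%N ->
  measurable_fun [set: g_sigma_algebraType (@filt _ X n)]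
    (fun w : g_sigma_algebraType (@filt _ X n) => (w : nat -> X) k).
Proof.
move=> kn _ Y mY; rewrite setTI measurable_filt; exact: filt_coord.
Qed.

Lemma measurable_id_filt n : measurable_fun [set: seq_space X]
  (id : seq_space X -> g_sigma_algebraType (@filt _ X n)).
Proof.
move=> _ Y; rewrite measurable_filt setTI preimage_id.
exact: filt_measurable.
Qed.

Lemma filt_cylinder n A : (forall k, measurable (A k)) ->
  @filt _ X n (cylinder n A).
Proof.
move=> mA; rewrite -measurable_filt.
have -> : cylinder n A = \bigcap_k
    (if (k < n)%N then [set w : seq_space X | A k (w k)] else setT).
  apply/seteqP; split => w /= h k.
    by move=> _; case: ifPn => // kn; exact: h.
  by move=> kn; have := h k I; rewrite kn.
apply: bigcapT_measurable => k; case: ifPn => // kn.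
by rewrite measurable_filt; exact: filt_coord.
Qed.

(** The pi-lambda theorem: cylinders are stable under intersection and generate [filt]. *)
Lemma filt_dynkin n (H : set (set (seq_space X))) : dynkin H ->
  (forall A, (forall k, measurable (A k)) -> H (cylinder n A)) ->
  @filt _ X n `<=` H.
Proof.
move=> dH hH.
pose C : set (set (seq_space X)) :=
  [set cylinder n A | A in [set A | forall k, measurable (A k)]].
have CI : setI_closed C.
  move=> _ _ [A1 mA1 <-] [A2 mA2 <-].
  exists (fun k => A1 k `&` A2 k); first by move=> k; exact: measurableI.
  apply/seteqP; split => w /=.
    by move=> h; split=> k kn; have [] := h k kn.
  by move=> [h1 h2] k kn; split; [exact: h1|exact: h2].
have sCH : <<s C >> `<=` H.
  rewrite -(setI_closed_g_dynkin_g_sigma_algebra CI).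
  by apply: smallest_sub => // _ [A mA <-]; exact: hH.
apply: subset_trans sCH; apply: filt_sub => [|k B kn mB].
  exact: smallest_sigma_algebra.
apply: sub_sigma_algebra; exists (fun j => if j == k then B else setT).
  by move=> j /=; case: ifPn.
apply/seteqP; split => w /=; last by move=> Bw j jn; case: eqP => // ->.
by move=> /(_ k kn); rewrite eqxx.
Qed.

(** The sets on which the integrals agree form a Dynkin class; closure under complements subtracts
    the integral over the set, hence the finite total integral. *)
Lemma filt_integral_ext (R : realType) n
    (m1 m2 : {measure set (seq_space X) -> \bar R})
    (u v : seq_space X -> \bar R) :
  measurable_fun setT u -> measurable_fun setT v ->
  (forall w, 0 <= u w) -> (forall w, 0 <= v w) ->
  \int[m1]_w u w < +oo ->
  (forall A, (forall k, measurable (A k)) ->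
    \int[m1]_(w in cylinder n A) u w = \int[m2]_(w in cylinder n A) v w) ->
  forall C, @filt _ X n C -> \int[m1]_(w in C) u w = \int[m2]_(w in C) v w.
Proof.
move=> mu mv u0 v0 ufin h C FC.
have uvT : \int[m1]_w u w = \int[m2]_w v w.
  have := h (fun=> setT) (fun=> measurableT).
  by have -> : cylinder n (fun=> setT) = setT by apply/seteqP.
have split_int (m : {measure set (seq_space X) -> \bar R}) f B :
    measurable_fun setT f -> (forall w, 0 <= f w) ->
    @measurable _ (seq_space X) B ->
    \int[m]_w f w = \int[m]_(w in B) f w + \int[m]_(w in ~` B) f w.
  move=> mf f0 mB; rewrite -(setUv B) ge0_integral_setU//.
  - exact: measurableC.
  - exact: measurable_funTS.
  - by apply/disj_setPCl.
pose H := [set B | @filt _ X n B /\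
  \int[m1]_(w in B) u w = \int[m2]_(w in B) v w].
suff : H C by case.
apply: (@filt_dynkin n) FC => [|A mA]; last first.
  by split; [exact: filt_cylinder|exact: h].
split.
- by split=> //; rewrite -measurable_filt; exact: measurableT.
- move=> B [FB eB]; split.
    by rewrite -measurable_filt; apply: measurableC; rewrite measurable_filt.
  have mB := filt_measurable FB.
  have uBfin : \int[m1]_(w in B) u w \is a fin_num.
    rewrite ge0_fin_numE ?integral_ge0//; apply: le_lt_trans ufin.
    by apply: ge0_subset_integral.
  have := split_int m2 v B mv v0 mB; rewrite -uvT -eB (split_int m1 u B)//.
  rewrite addeC [in RHS]addeC => /(congr1 (fun z => z - \int[m1]_(w in B) u w)).
  by rewrite !addeK.
- move=> F tF HF; split.
    rewrite -measurable_filt; apply: bigcupT_measurable => k.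
    by rewrite measurable_filt; have [] := HF k.
  have mF k := filt_measurable (HF k).1.
  rewrite !ge0_integral_bigcup//; last 2 first.
    exact: measurable_funTS.
    exact: measurable_funTS.
  by apply: eq_eseriesr => k _; have [] := HF k.
Qed.

End coordinates.

Section iid.
Context d (X : measurableType d) (R : realType).
Variables (P : probability X R) (PP : probability (seq_space X) R).
Hypothesis hPP : is_iid_law P PP.

Lemma iid_cylinder n (A : nat -> set X) : (forall k, measurable (A k)) ->
  PP (cylinder n A) = \prod_(k < n) P (A k).
Proof. by move=> mA; rewrite hPP. Qed.

(** Writing both sides as integrals over [C], of an indicator and of a constant, reduces the claim
    to cylinders. *)
Lemma iid_indep n (C : set (seq_space X)) (B : set X) :
  @filt _ X n C -> measurable B ->
  PP (C `&` [set w | B (w n)]) = PP C * P B.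
Proof.
move=> FC mB.
have mBn : @measurable _ (seq_space X) [set w | B (w n)].
  by apply: (@filt_measurable _ _ n.+1); exact: filt_coord.
have mC := filt_measurable FC.
have <- : \int[PP]_(w in C) (\1_[set w : seq_space X | B (w n)] w)%:E =
    PP (C `&` [set w | B (w n)]) by rewrite integral_indic// setIC.
have <- : \int[PP]_(w in C) (cst (P B) w) = PP C * P B.
  by rewrite integral_cst// muleC.
apply: filt_integral_ext FC => //.
- by apply/measurable_EFinP; exact: measurable_indic.
- by rewrite integral_indic// setIT (le_lt_trans (probability_le1 _ _))// ltry.
move=> A mA; have FA := filt_measurable (@filt_cylinder _ _ n _ mA).
rewrite integral_indic// integral_cst//.
have -> : [set w | B (w n)] `&` cylinder n A =
    cylinder n.+1 (fun k => if k == n then B else A k).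
  apply/seteqP; split => w /=.
    move=> [Bw Aw] k; rewrite ltnS leq_eqVlt.
    by case: eqP => [-> //|_ /= kn]; exact: Aw.
  move=> h; split; first by have := h n (ltnSn n); rewrite eqxx.
  by move=> k kn; have := h k (ltnW kn); rewrite ltn_eqF.
etransitivity; first by apply: iid_cylinder => k; case: ifPn.
rewrite big_ord_recr /= eqxx muleC; congr (_ * _).
apply/esym; etransitivity; first exact: iid_cylinder.
by apply: eq_bigr => k _; rewrite ltn_eqF.
Qed.

Lemma iid_integral_filt n (C : set (seq_space X)) (g : X -> \bar R) :
  @filt _ X n C -> measurable_fun setT g -> (forall x, 0 <= g x) ->
  \int[PP]_(w in C) g (w n) = PP C * \int[P]_x g x.
Proof.
move=> FC mg g0; have mC := filt_measurable FC.
have := @integral_transfer _ _ _ _ _ _ R PP P (fun w : seq_space X => w n) id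
  (fun w => (\1_C w)%:E) (cst (PP C)) g (@measurable_coord _ _ n) _ _ _ _ _ _ mg g0.
have -> : \int[P]_x (g (id x) * cst (PP C) x) = PP C * \int[P]_x g x.
  by rewrite -ge0_integralZl//; apply: eq_integral => x _; rewrite muleC.
have -> : \int[PP]_w (g (w n) * (\1_C w)%:E) = \int[PP]_(w in C) g (w n).
  by rewrite [RHS]integral_mkcond; apply: eq_integral => w _; rewrite epatch_indic.
apply => //.
- by apply/measurable_EFinP; exact: measurable_indic.
- move=> B mB.
  have mBn : @measurable _ (seq_space X) [set w | B (w n)].
    by apply: (@filt_measurable _ _ n.+1); exact: filt_coord.
  by rewrite integral_cst// integral_indic//; exact: iid_indep.
Qed.

(** A transfer along the identity into [F_n]: [g] at coordinate [n] and the constant mean of [g]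
    have the same integrals over every set of [F_n]. *)
Lemma iid_integral_mul n (Y : seq_space X -> \bar R) (g : X -> \bar R) :
  measurable_wrt (@filt _ X n) Y -> (forall w, 0 <= Y w) ->
  measurable_fun setT g -> (forall x, 0 <= g x) ->
  \int[PP]_w (Y w * g (w n)) = \int[PP]_w Y w * \int[P]_x g x.
Proof.
move=> mY Y0 mg g0; have mY' := measurable_wrt_measurable mY.
rewrite -ge0_integralZr//; last exact: integral_ge0.
pose c := \int[P]_x g x.
have c0 : 0 <= c by exact: integral_ge0.
have mid := @measurable_id_filt _ X n.
have mgn := measurableT_comp mg (@measurable_coord _ X n).
apply: (@integral_transfer _ _ _ (seq_space X) (seq_space X)
  (g_sigma_algebraType (@filt _ X n)) R PP PP id id (fun w => g (w n))
  (cst c) Y mid mid mgn) => //.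
move=> C; rewrite measurable_filt preimage_id => FC.
rewrite integral_cst; last exact: filt_measurable FC.
by rewrite muleC; exact: iid_integral_filt.
Qed.

Lemma iid_integral_prod n (f : nat -> X -> \bar R) :
  (forall k, measurable_fun setT (f k)) -> (forall k x, 0 <= f k x) ->
  \int[PP]_w (\prod_(k < n) f k (w k)) = \prod_(k < n) \int[P]_x f k x.
Proof.
move=> mf f0; elim: n => [|n IH].
  rewrite big_ord0; under eq_integral do rewrite big_ord0.
  by rewrite integral_cst// mul1e; exact: probability_setT.
rewrite [RHS]big_ord_recr /= -IH.
transitivity (\int[PP]_w ((\prod_(k < n) f k (w k)) * f n (w n))).
  by apply: eq_integral => w _; rewrite big_ord_recr.
apply: iid_integral_mul => //.
- apply: (@emeasurable_prod_ord _ (g_sigma_algebraType (@filt _ X n)) R setT n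
    (fun k (w : seq_space X) => f k (w k))) => k kn.
  exact: (measurableT_comp (mf k) (measurable_wrt_coord kn)).
- by move=> w; exact: prode_ge0.
Qed.

Lemma iid_coord_null n (N : set X) : measurable N -> P N = 0 ->
  PP [set w | N (w n)] = 0.
Proof.
move=> mN PN; have FT : @filt _ X n setT.
  by rewrite -measurable_filt; exact: measurableT.
by have := iid_indep FT mN; rewrite setTI PN mule0.
Qed.

End iid.

(** * Likelihood ratio of finitely many observations *)

Section change_of_measure.
Context d (X : measurableType d) (R : realType).

Section density.
Variables (Q P : probability X R).
Hypothesis QP : Q `<< P.

Lemma density_ge0 x : 0 <= density Q P x.
Proof. exact: Radon_Nikodym_SigmaFinite.f_ge0. Qed.

Lemma density_fin_num x : density Q P x \is a fin_num.
Proof. exact: Radon_Nikodym_SigmaFinite.f_fin_num. Qed.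

Lemma measurable_density : measurable_fun setT (density Q P).
Proof. exact: measurable_int (Radon_Nikodym_SigmaFinite.f_integrable QP). Qed.

Lemma integral_density A : measurable A -> \int[P]_(x in A) density Q P x = Q A.
Proof. by move=> mA; rewrite -Radon_Nikodym_SigmaFinite.f_integral. Qed.

Lemma integral_density_mul (f : X -> \bar R) :
  measurable_fun setT f -> (forall x, 0 <= f x) ->
  \int[P]_x (f x * density Q P x) = \int[Q]_x f x.
Proof. by move=> mf f0; exact: Radon_Nikodym_SigmaFinite.change_of_variables. Qed.

End density.

Variables (Q P : probability X R) (QQ PP : probability (seq_space X) R).
Hypotheses (QP : Q `<< P) (hQQ : is_iid_law Q QQ) (hPP : is_iid_law P PP).

Definition density_prod n (w : seq_space X) : \bar R :=
  \prod_(k < n) density Q P (w k).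

Lemma density_prod_ge0 n w : 0 <= density_prod n w.
Proof. by apply: prode_ge0 => k _; exact: density_ge0. Qed.

Lemma measurable_wrt_density_prod n :
  measurable_wrt (@filt _ X n) (density_prod n).
Proof.
apply: (@emeasurable_prod_ord _ (g_sigma_algebraType (@filt _ X n)) R setT n
  (fun k (w : seq_space X) => density Q P (w k))) => k kn.
exact: (measurableT_comp (measurable_density QP) (measurable_wrt_coord kn)).
Qed.

(** [density_prod n] is the density of [QQ] with respect to [PP] on [F_n]; on cylinders this is the
    product formula, and the transfer passes to arbitrary nonnegative [Y]. *)
Lemma integral_density_prod n (Y : seq_space X -> \bar R) :
  measurable_wrt (@filt _ X n) Y -> (forall w, 0 <= Y w) ->
  \int[PP]_w (Y w * density_prod n w) = \int[QQ]_w Y w.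
Proof.
move=> mY Y0.
have -> : \int[QQ]_w Y w = \int[QQ]_w (Y w * cst 1 w).
  by apply: eq_integral => w _; rewrite mule1.
have mid := @measurable_id_filt _ X n.
have mD := measurable_wrt_measurable (@measurable_wrt_density_prod n).
apply: (@integral_transfer _ _ _ (seq_space X) (seq_space X)
  (g_sigma_algebraType (@filt _ X n)) R PP QQ id id (density_prod n)
  (cst 1) Y mid mid mD) => //; first exact: density_prod_ge0.
move=> C; rewrite measurable_filt preimage_id => FC.
have int_cyl A : (forall k, measurable (A k)) ->
    \int[PP]_(w in cylinder n A) density_prod n w = \prod_(k < n) Q (A k).
  move=> mA; transitivity (\int[PP]_w \prod_(k < n)
      ((density Q P \_ (A k)) (w k))).
    rewrite integral_mkcond; apply: eq_integral => w _; rewrite patchE.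
    case: ifPn => [|/negP]; rewrite inE => Cw.
      by apply: eq_bigr => k _; rewrite patchE mem_set//; exact: Cw.
    have [k /= kn nA] : exists2 k, (k < n)%N & ~ A k (w k).
      apply: contrapT => h; apply: Cw => k kn; apply: contrapT => nA.
      by apply: h; exists k.
    by rewrite (bigD1 (Ordinal kn))//= patchE memNset// mul0e.
  etransitivity.
    apply: (iid_integral_prod hPP n (f := fun k => density Q P \_ (A k))).
  - move=> k; apply/(measurable_restrictT _ (mA k)).1.
    exact/measurable_funTS/measurable_density.
  - by move=> k x; rewrite patchE; case: ifPn => // _; exact: density_ge0.
  - by apply: eq_bigr => k _; rewrite -integral_mkcond integral_density.
apply: filt_integral_ext FC => //; first exact: density_prod_ge0.
- have := int_cyl (fun=> setT) (fun=> measurableT).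
  have -> : cylinder n (fun=> setT) = setT :> set (seq_space X).
    by apply/seteqP.
  move=> ->; rewrite big1 ?ltry// => k _; exact: probability_setT.
- move=> A mA; rewrite int_cyl// integral_cst ?mul1e.
    by apply/esym; exact: iid_cylinder.
  exact: filt_measurable (@filt_cylinder _ _ _ _ mA).
Qed.

End change_of_measure.

(** * Wealth processes and their mean *)

Section wealth.
Context d (X : measurableType d) (R : realType).
Variables (PP : probability (seq_space X) R).
Variable B : nat -> seq_space X -> \bar R.
Hypothesis hB : betting PP B.

Lemma measurable_wrt_wealth t : measurable_wrt (@filt _ X t) (wealth B t).
Proof.
apply: (@emeasurable_prod_ord _ (g_sigma_algebraType (@filt _ X t)) R setT t B)
  => k kn; have [mB _ _] := hB k.
exact: measurable_wrt_mono mB.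
Qed.

Lemma wealth_ge0 t w : 0 <= wealth B t w.
Proof. by apply: prode_ge0 => k _; have [] := hB k. Qed.

Lemma integral_wealth_le1 t : \int[PP]_w wealth B t w <= 1.
Proof.
elim: t => [|t IH].
  rewrite /wealth; under eq_integral do rewrite big_ord0.
  by rewrite integral_cst// mul1e; exact: probability_le1.
apply: le_trans IH.
have [mB B0 [Z [[mZ Z0 ZB] Z1]]] := hB t.
have mW := @measurable_wrt_wealth t.
have mZ' := measurable_wrt_measurable mZ.
have mW' := measurable_wrt_measurable mW.
have mid := @measurable_id_filt _ X t.
have -> : \int[PP]_w wealth B t.+1 w = \int[PP]_w (wealth B t w * Z w).
  have -> : \int[PP]_w wealth B t.+1 w = \int[PP]_w (wealth B t w * B t w).
    by apply: eq_integral => w _; rewrite /wealth big_ord_recr.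
  (* The bet is replaced by its conditional expectation [Z]: both have the same integrals over sets
     of [F_t], and the earlier wealth is [F_t]-measurable. *)
  apply: (@integral_transfer _ _ _ (seq_space X) (seq_space X)
    (g_sigma_algebraType (@filt _ X t)) R PP PP id id (B t) Z
    (wealth B t) mid mid (measurable_wrt_measurable mB) mZ') => //.
  - by move=> C; rewrite measurable_filt preimage_id => FC; rewrite ZB.
  - exact: wealth_ge0.
apply: ae_ge0_le_integral => //.
- by move=> w _; rewrite mule_ge0// wealth_ge0.
- exact: emeasurable_funM.
- by move=> w _; exact: wealth_ge0.
- apply: filterS Z1 => w Zw _; rewrite -[leRHS]mule1 lee_wpmul2l//.
  exact: wealth_ge0.
Qed.

End wealth.

(** * Elementary inequalities *)

Section real_inequalities.
Context (R : realType).
Implicit Types x y b p : R.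
Local Open Scope ring_scope.

(** Young's inequality with conjugate exponents [1/b] and [1/(1-b)]; at [b = 1] the second is
    infinite, so that case is separate. *)
Lemma powR_wamgm b x y : 0 < b <= 1 -> 0 <= x -> 0 <= y ->
  x `^ b * y `^ (1 - b) <= b * x + (1 - b) * y.
Proof.
move=> /andP[b0]; rewrite le_eqVlt => /predU1P[->|b1] x0 y0.
  by rewrite subrr powRr0 powRr1// mulr1 mul0r addr0 mul1r.
have b1' : 0 < 1 - b by rewrite subr_gt0.
have e : b^-1^-1 + (1 - b)^-1^-1 = 1 by rewrite !invrK addrC subrK.
have := conjugate_powR (powR_ge0 x b) (powR_ge0 y (1 - b)) _ _ e.
rewrite !invr_gt0 => /(_ b0 b1').
by rewrite !invrK -!powRrM !divff ?gt_eqF// !powRr1// ![_ * b]mulrC ![_ * (1 - b)]mulrC.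
Qed.

Lemma powR_bernoulli p x : 0 < p <= 1 -> 0 <= x -> x `^ p <= 1 + p * (x - 1).
Proof.
move=> p01 x0; have := powR_wamgm p01 x0 ler01.
by rewrite powR1 mulr1 => /le_trans; apply; lra.
Qed.

Lemma ln_lt_sub1 x : 0 < x -> x != 1 -> ln x < x - 1.
Proof.
move=> x0 x1; have lnx : ln x != 0 by rewrite ln_eq0.
have := expR_gt1Dx lnx; rewrite lnK ?posrE//; lra.
Qed.

Lemma ln_le_sub1 x : 0 < x -> ln x <= x - 1.
Proof.
by move=> x0; have := @le_ln1Dx R (x - 1); rewrite [1 + _]addrC subrK; apply; lra.
Qed.

(** Bernoulli's inequality for [x ^ b] with exponent [b'/b]. This monotonicity is what allows
    monotone convergence as [b] tends to 0. *)
Lemma powR_diff_quotient_ninc x b b' : 0 <= x -> 0 < b' -> b' <= b ->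
  (1 - x `^ b) / b <= (1 - x `^ b') / b'.
Proof.
move=> x0 b'0 bb'; have b0 : 0 < b by exact: lt_le_trans bb'.
have p01 : 0 < b' / b <= 1 by rewrite divr_gt0//= ler_pdivrMr// mul1r.
have := powR_bernoulli p01 (powR_ge0 x b).
rewrite -powRrM mulrCA divff ?gt_eqF// mulr1 => h.
rewrite ler_pdivlMr// mulrAC ler_pdivrMr//.
move: h; rewrite -(ler_pM2r b0) mulrDl mulrAC.
rewrite (_ : b' / b * b = b') ?divfK ?gt_eqF//; lra.
Qed.

End real_inequalities.

Section measurability.
Context (R : realType).

Lemma measurable_inve : measurable_fun [set: \bar R] (@inve R).
Proof.
(* A finite nonzero [r] has inverse [r * (r ^ 2)^-1]; squaring makes the base of the power
   positive. *)
have -> : @inve R = fun x => if x == 0 then +oo else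
    if x == +oo then 0 else if x == -oo then -oo else
    (fine x * (fine x ^+ 2) `^ (-1))%:E.
  apply/funext => x; case: inveP => //= [|r r0]; first by rewrite eqxx.
  rewrite eqe (negbTE r0) powR_inv1 ?sqr_ge0// expr2 invfM mulrA divff// mul1r//.
have mf : measurable_fun [set: \bar R] (@fine R) by exact: fine_measurable.
apply: measurable_fun_ifT => //; first exact: measurable_fun_eqe.
apply: measurable_fun_ifT => //; first exact: measurable_fun_eqe.
apply: measurable_fun_ifT => //; first exact: measurable_fun_eqe.
apply/measurable_EFinP; apply: measurable_funM => //.
apply: (measurableT_comp (measurable_powR _)).
exact: measurable_funX.
Qed.

Lemma measurable_lneEFin : measurable_fun [set: R] (fun r => lne r%:E).
Proof.
apply: measurable_fun_ifT => //=.
  exact: measurable_fun_ler.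
by apply/measurable_EFinP; exact: measurable_ln.
Qed.

Lemma measurable_inve_poweR d (T : measurableType d) (W : T -> \bar R) (s : R) :
  measurable_fun setT W -> measurable_fun setT (fun w => (W w `^ s)^-1).
Proof.
move=> mW; apply: (measurableT_comp measurable_inve).
exact: (measurableT_comp (measurable_poweR _)).
Qed.

End measurability.

Section log_gap.
Context (R : realType).
Implicit Types y : R.

(** Nonnegative, zero only at 1, infinite at 0. At a density with respect to [P0], the term [y - 1]
    integrates to 0 and only [- lne] remains. *)
Definition log_gap y : \bar R := (y - 1)%:E - lne y%:E.

Lemma log_gap_EFin y : (0 < y)%R -> log_gap y = (y - 1 - ln y)%:E.
Proof. by move=> y0; rewrite /log_gap lne_EFin. Qed.

Lemma log_gap0 : log_gap 0 = +oo.
Proof. by rewrite /log_gap le0_lneNy. Qed.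

Lemma log_gap_ge0 y : (0 <= y)%R -> 0 <= log_gap y.
Proof.
rewrite le_eqVlt => /predU1P[<-|y0]; first by rewrite log_gap0.
by rewrite log_gap_EFin// lee_fin subr_ge0 ln_le_sub1.
Qed.

Lemma log_gap_eq0 y : (0 <= y)%R -> log_gap y = 0 -> y = 1%R.
Proof.
rewrite le_eqVlt => /predU1P[<-|y0]; first by rewrite log_gap0.
rewrite log_gap_EFin// => -[] h; apply/eqP; apply: contraT => y1.
by have := ln_lt_sub1 y0 y1; rewrite ltNge -subr_le0 -(subr0 (ln y)) -h; lra.
Qed.

Lemma measurable_log_gap : measurable_fun [set: R] log_gap.
Proof.
apply: emeasurable_funB; last exact: measurable_lneEFin.
by apply/measurable_EFinP; exact: measurable_funB.
Qed.

End log_gap.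

Section extended_powers.
Context (R : realType).

Lemma lne_prod_const t (M : \bar R) : 0 <= M -> (0 < t)%N ->
  lne (\prod_(k < t) M) = (t%:R)%:E * lne M.
Proof.
move=> + t0; rewrite le_eqVlt => /predU1P[<-|M0].
  rewrite [in RHS]le0_lneNy// gt0_muleNy ?lte_fin ?ltr0n//.
  by case: t t0 => // t _; rewrite big_ord_recl mul0e le0_lneNy.
have prod_gt0 n : 0 < \prod_(k < n) M.
  by elim/big_ind : _ => // x y; exact: mule_gt0.
elim: t {t0} => [|t IH]; first by rewrite big_ord0 lne1 mul0e.
have pos (x : \bar R) : 0 < x -> x \in `]0, +oo] by move=> x0; rewrite in_itv/= x0 leey.
rewrite big_ord_recr /= (lneM (pos _ (prod_gt0 t)) (pos _ M0)) IH.
by rewrite -natr1 EFinD ge0_muleDl ?lee_fin// mul1e.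
Qed.

(** The pointwise form of Markov's inequality for [W ^ (-s)]. It yields the error bound and, with
    [a = 1], a moment at least 1 when [W <= 1]. *)
Lemma inve_powR_ge1 (a s : R) (W : \bar R) : (0 < a)%R -> (0 <= s)%R ->
  0 <= W -> W <= a%:E -> 1 <= (a `^ s)%:E * (W `^ s)^-1.
Proof.
move=> a0 s0; case: W => [w| |] // w0; rewrite lee_fin in w0 *.
rewrite lee_fin => wa; have as0 : (0 < a `^ s)%R by rewrite powR_gt0.
rewrite poweR_EFin inver; case: eqP => [_|/eqP ws].
  by rewrite gt0_muley ?lte_fin// leey.
rewrite -EFinM lee_fin ler_pdivlMr ?mul1r.
  by rewrite ge0_ler_powR// nnegrE// ltW.
by rewrite lt_neqAle eq_sym ws powR_ge0.
Qed.

(** From [W ^ (-s) >= 1 - s * ln W] and [- ln W >= 1 - W]. Being linear in [s], the integrated bound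
    exceeds 1 for large [s] as soon as [W < 1] has positive probability. *)
Lemma inve_poweR_tangent (s : R) (W : \bar R) : (0 <= s)%R -> 0 <= W ->
  s%:E * maxe (1 - W) 0 <= (W `^ s)^-1.
Proof.
move=> s0 W0; have [W1|W1] := leP 1 W.
  rewrite max_r; last by rewrite sube_le0.
  by rewrite mule0 inve_ge0 poweR_ge0.
rewrite max_l; last by apply: ltW; rewrite sube_gt0.
case: W W0 W1 => [w| |] //; rewrite lee_fin lte_fin => w0 w1.
rewrite poweR_EFin inver; case: eqP => [_|/eqP ws]; first by rewrite leey.
rewrite -EFinB -EFinM lee_fin.
(* The inverse is finite in this branch, so [w = 0] forces [s = 0]. *)
move: w0; rewrite le_eqVlt => /predU1P[w0|w0].
  move: ws; rewrite -w0 powR_eq0 eqxx/= negbK => /eqP ->.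
  by rewrite mul0r invr_ge0 powR_ge0.
rewrite -powRN; have := ln_le_sub1 (powR_gt0 (- s) w0); rewrite ln_powR.
have : (s * (1 - w) <= s * - ln w)%R.
  by rewrite ler_wpM2l//; have := ln_le_sub1 w0; lra.
lra.
Qed.

End extended_powers.

(** * Kullback-Leibler and Renyi divergences *)

Section kl_renyi.
Context d (X : measurableType d) (R : realType).
Variables (P0 P1 : probability X R).
Hypothesis hac : P1 `<< P0.
Implicit Types b : R.

Let rho x : R := fine (density P1 P0 x).

Lemma density_rho x : density P1 P0 x = (rho x)%:E.
Proof. by rewrite fineK// density_fin_num. Qed.

Lemma rho_ge0 x : (0 <= rho x)%R.
Proof. by rewrite fine_ge0// density_ge0. Qed.

Lemma measurable_rho : measurable_fun setT rho.
Proof.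
exact: (measurableT_comp (fine_measurable _) (measurable_density hac)).
Qed.

Lemma measurable_rho_powR b : measurable_fun setT (fun x => (rho x `^ b)%R).
Proof. exact: (measurableT_comp (measurable_powR b) measurable_rho). Qed.

Lemma integral_rho : \int[P0]_x (rho x)%:E = 1.
Proof.
have := integral_density hac measurableT; rewrite probability_setT => <-.
by apply: eq_integral => x _; rewrite density_rho.
Qed.

Definition renyi_moment b : R := fine (Zbeta P0 P1 b).

Lemma Zbeta_int b : Zbeta P0 P1 b = \int[P0]_x (rho x `^ b)%:E.
Proof. by apply: eq_integral => x _; rewrite density_rho poweR_EFin. Qed.

Lemma Zbeta_le1 b : (0 < b <= 1)%R -> Zbeta P0 P1 b <= 1.
Proof.
move=> b01; have /andP[b0 b1] := b01; rewrite Zbeta_int.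
(* The affine majorant of [rho ^ b] given by Bernoulli's inequality has mean 1, because [rho]
   has. *)
have -> : 1 = \int[P0]_x (b%:E * (rho x)%:E + (1 - b)%:E).
  rewrite ge0_integralD//.
  - rewrite ge0_integralZl ?lee_fin ?ltW//.
    + rewrite integral_rho integral_cst_probability mule1 -EFinD.
      by rewrite addrC subrK.
    + by apply/measurable_EFinP; exact: measurable_rho.
    + by move=> x _; rewrite lee_fin rho_ge0.
  - by move=> x _; rewrite -EFinM lee_fin mulr_ge0 ?rho_ge0// ltW.
  - apply/measurable_EFinP; apply: measurable_funM => //; exact: measurable_rho.
  - by move=> x _; rewrite lee_fin subr_ge0.
apply: ge0_le_integral => //.
- by move=> x _; rewrite lee_fin powR_ge0.
- by apply/measurable_EFinP; exact: measurable_rho_powR.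
- apply/measurable_EFinP; apply: measurable_funD => //.
  by apply: measurable_funM => //; exact: measurable_rho.
- move=> x _; rewrite lee_fin.
  by have := powR_bernoulli b01 (rho_ge0 x); lra.
Qed.

Lemma Zbeta_gt0 b : (0 < b)%R -> 0 < Zbeta P0 P1 b.
Proof.
move=> b0; rewrite Zbeta_int lt0e integral_ge0 ?andbT; last first.
  by move=> x _; rewrite lee_fin powR_ge0.
apply/negP => /eqP Z0.
have : 1 = 0 :> \bar R; last by move/eqP; rewrite onee_eq0.
rewrite -integral_rho.
have mr := measurable_rho; have mrb := measurable_rho_powR b.
have mrbE : measurable_fun setT (fun x => (rho x `^ b)%:E).
  exact/measurable_EFinP.
have /(ae_eq_integral_abs P0 measurableT mrbE) h :
    \int[P0]_x `|(rho x `^ b)%:E| = 0.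
  by rewrite -[RHS]Z0; apply: eq_integral => x _; rewrite gee0_abs// lee_fin powR_ge0.
rewrite -[RHS](integral0 P0 setT); apply: ge0_ae_eq_integral => //.
- by apply/measurable_EFinP.
- by move=> x _; rewrite lee_fin rho_ge0.
apply: filterS h => x /(_ I) [] /eqP.
by rewrite powR_eq0 => /andP[/eqP -> _].
Qed.

Lemma ZbetaE b : (0 < b <= 1)%R -> Zbeta P0 P1 b = (renyi_moment b)%:E.
Proof.
move=> b01; rewrite fineK// ge0_fin_numE ?(le_lt_trans (Zbeta_le1 b01)) ?ltry//.
by apply/ltW/Zbeta_gt0; case/andP: b01.
Qed.

Lemma renyi_moment_gt0 b : (0 < b <= 1)%R -> (0 < renyi_moment b)%R.
Proof.
by move=> b01; rewrite -lte_fin -ZbetaE// Zbeta_gt0//; case/andP: b01.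
Qed.

Lemma renyi_moment_le1 b : (0 < b <= 1)%R -> (renyi_moment b <= 1)%R.
Proof. by move=> b01; rewrite -lee_fin -ZbetaE// Zbeta_le1. Qed.

Lemma integral_rho_powR b : (0 < b <= 1)%R ->
  \int[P0]_x (rho x `^ b)%:E = (renyi_moment b)%:E.
Proof. by move=> b01; rewrite -ZbetaE// Zbeta_int. Qed.

(* The Renyi divergence of order 1 - b of P0 from P1. *)
Definition renyi b : R := (- (b^-1 * ln (renyi_moment b)))%R.

Lemma renyi_ge0 b : (0 < b <= 1)%R -> (0 <= renyi b)%R.
Proof.
move=> b01; rewrite oppr_ge0 pmulr_rle0 ?invr_gt0; last by case/andP: b01.
by rewrite ln_le0// renyi_moment_le1.
Qed.

Lemma measurable_log_gap_rho : measurable_fun setT (fun x => log_gap (rho x)).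
Proof. exact: (measurableT_comp (@measurable_log_gap R) measurable_rho). Qed.

Lemma measurable_lne_rho : measurable_fun setT (fun x => lne (rho x)%:E).
Proof. exact: (measurableT_comp (@measurable_lneEFin R) measurable_rho). Qed.

(* The integrand is not of constant sign; adding rho - 1, which has integral 0,
   makes it nonnegative. *)
Lemma integral_lne_rho :
  \int[P0]_x - lne (rho x)%:E = \int[P0]_x log_gap (rho x).
Proof.
pose f x := - lne (rho x)%:E.
have mf : measurable_fun setT f by exact: measurableT_comp measurable_lne_rho.
have mr : measurable_fun setT (fun x => (rho x)%:E).
  by apply/measurable_EFinP; exact: measurable_rho.
have mg := measurable_log_gap_rho.
have g0 x : setT x -> 0 <= log_gap (rho x).
  by move=> _; exact: log_gap_ge0 (rho_ge0 x).
have r0 x : setT x -> 0 <= (rho x)%:E by rewrite lee_fin rho_ge0.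
(* The logarithm lies below the identity, so the negative part of [- lne rho] has mean at most 1 and
   can be cancelled. *)
have fneg_le x : f^\- x <= (rho x)%:E.
  rewrite funenegE /f oppeK ge_max r0// andbT.
  by apply/ltW/lne_sublinear.
have fnegfin : \int[P0]_x f^\- x \is a fin_num.
  rewrite ge0_fin_numE ?integral_ge0//.
  apply: (@le_lt_trans _ _ (\int[P0]_x (rho x)%:E)).
    by apply: ge0_le_integral => //; exact: measurable_funeneg.
  by rewrite integral_rho ltry.
(* Written without subtraction: all terms are nonnegative, and where [rho = 0] both sides are
   [+oo]. *)
have split x : log_gap (rho x) + (f^\- x + 1) = f^\+ x + (rho x)%:E.
  have := rho_ge0 x; rewrite funeposE funenegE /log_gap /f le_eqVlt.
  move=> /predU1P[<-|rx0]; first by rewrite le0_lneNy//= maxye maxNye add0e adde0.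
  rewrite lne_EFin// oppeK -EFinN; have [l0|l0] := leP 0%R (ln (rho x)).
    rewrite max_l ?lee_fin// max_r ?lee_fin ?oppr_le0// -!EFinD.
    by congr _%:E; lra.
  rewrite max_r ?lee_fin ?ltW// max_l ?lee_fin ?oppr_ge0 ?ltW// -!EFinD.
  by congr _%:E; lra.
have mfn : measurable_fun setT f^\- by exact: measurable_funeneg.
have mfp : measurable_fun setT f^\+ by exact: measurable_funepos.
have eL : \int[P0]_x (log_gap (rho x) + (f^\- x + 1)) =
    \int[P0]_x log_gap (rho x) + (\int[P0]_x f^\- x + 1).
  rewrite ge0_integralD//; last 2 first.
  - by move=> x _; rewrite adde_ge0.
  - exact: emeasurable_funD.
  congr (_ + _); rewrite ge0_integralD//; congr (_ + _).
  exact: integral_cst_probability.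
have eR : \int[P0]_x (f^\+ x + (rho x)%:E) = \int[P0]_x f^\+ x + 1.
  by rewrite ge0_integralD// integral_rho.
have : \int[P0]_x (log_gap (rho x) + (f^\- x + 1)) =
    \int[P0]_x (f^\+ x + (rho x)%:E).
  by apply: eq_integral => x _; rewrite split.
rewrite eL eR addeA.
move=> /(congr1 (fun z => z - 1)); rewrite !addeK// => e.
by rewrite [LHS]integralE -e addeK.
Qed.

(** If [P1] dominates [P0], the two densities are almost surely reciprocal. Otherwise some set is
    null for [P1] but not for [P0]; there [rho = 0] almost surely, the integrand is [+oo], and both
    sides are infinite. *)
Lemma KL_log_gap : KL P0 P1 = \int[P0]_x log_gap (rho x).
Proof.
rewrite /KL; case: asboolP => [dom|ndom].
  rewrite -integral_lne_rho; apply: ae_eq_integral => //.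
  - have h := measurable_density dom.
    under eq_fun => x do rewrite -(fineK (density_fin_num dom x)).
    apply: (measurableT_comp (@measurable_lneEFin R)).
    exact: (measurableT_comp (fine_measurable _) h).
  - exact: measurableT_comp measurable_lne_rho.
  have mq := measurable_density dom.
  have mr := measurable_density hac.
  (* Over any [E] the product of the densities integrates to [P0 E], by changing measure to [P1] and
     back. *)
  have : ae_eq P0 setT (cst 1) (density P0 P1 \* density P1 P0).
    apply: integral_ae_eq => //.
    - exact: finite_measure_integrable_cst.
    - exact: emeasurable_funM.
    - move=> E _ mE; transitivity (P0 E); first by rewrite integral_cst// mul1e.
      rewrite -(integral_density dom mE).
      apply/esym/Radon_Nikodym_SigmaFinite.change_of_variables => //.
        by move=> x; exact: density_ge0.
      exact: measurable_funTS.
  apply: filterS => x /(_ I) /= + _; rewrite density_rho.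
  rewrite -(fineK (density_fin_num dom x)) -EFinM => -[] qr1.
  have r0 : (0 < rho x)%R.
    rewrite lt_neqAle rho_ge0 andbT; apply/negP => /eqP r0.
    by move: qr1; rewrite -r0 mulr0 => /eqP; rewrite oner_eq0.
  rewrite -lneV//; congr lne; congr _%:E; apply: (mulIf (lt0r_neq0 r0)).
  by rewrite -qr1 mulVf// lt0r_neq0.
have [A [mA P1A P0A]] : exists A, [/\ measurable A, P1 A = 0 & P0 A != 0].
  apply: contrapT => h; apply: ndom; apply/null_content_dominatesP => A mA P1A.
  by apply/eqP; apply: contrapT => /negP P0A; apply: h; exists A.
apply/esym/eqP; rewrite -leye_eq.
have mg : measurable_fun A (fun x => log_gap (rho x)).
  exact/measurable_funTS/measurable_log_gap_rho.
have mr : measurable_fun A (fun x => (rho x)%:E).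
  by apply/measurable_funTS/measurable_EFinP; exact: measurable_rho.
apply: (@le_trans _ _ (\int[P0]_(x in A) log_gap (rho x))); last first.
  apply: ge0_subset_integral => //; first exact: measurable_log_gap_rho.
  by move=> x _; exact: log_gap_ge0 (rho_ge0 x).
have /(ae_eq_integral_abs P0 mA mr) rA : \int[P0]_(x in A) `|(rho x)%:E| = 0.
  rewrite -P1A -(integral_density hac mA); apply: eq_integral => x _.
  by rewrite density_rho gee0_abs// lee_fin rho_ge0.
rewrite (@ae_eq_integral _ _ _ _ _ (cst +oo))//; last first.
  by apply: filterS rA => x rA Ax; have [->] := rA Ax; rewrite log_gap0.
rewrite integral_cst// gt0_mulye// lt_neqAle eq_sym P0A; exact: measure_ge0.
Qed.

Let rhoE_ge0 x : setT x -> 0 <= (rho x)%:E.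
Proof. by move=> _; rewrite lee_fin rho_ge0. Qed.

Let measurable_rhoE : measurable_fun setT (fun x => (rho x)%:E).
Proof. by apply/measurable_EFinP; exact: measurable_rho. Qed.

(** The real-valued form of [Rbeta], a probability density with respect to [P0] for [b] in
    [(0, 1]]. *)
Definition tilt b x : R := (rho x `^ b / renyi_moment b)%R.

Lemma tilt_ge0 b x : (0 < b <= 1)%R -> (0 <= tilt b x)%R.
Proof. by move=> b01; rewrite divr_ge0 ?powR_ge0// ltW// renyi_moment_gt0. Qed.

Lemma measurable_tilt b : measurable_fun setT (tilt b).
Proof. by apply: measurable_funM => //; exact: measurable_rho_powR. Qed.

Lemma integral_tilt b : (0 < b <= 1)%R -> \int[P0]_x (tilt b x)%:E = 1.
Proof.
move=> b01; have z0 := renyi_moment_gt0 b01.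
transitivity (\int[P0]_x ((renyi_moment b)^-1%:E * (rho x `^ b)%:E)).
  by apply: eq_integral => x _; rewrite -EFinM mulrC.
rewrite ge0_integralZl//.
- by rewrite integral_rho_powR// -EFinM mulVf// gt_eqF.
- by apply/measurable_EFinP; exact: measurable_rho_powR.
- by move=> x _; rewrite lee_fin powR_ge0.
- by rewrite lee_fin invr_ge0 ltW.
Qed.

Let log_gap_tilt_ge0 b x : (0 < b <= 1)%R -> 0 <= (b^-1)%:E * log_gap (tilt b x).
Proof.
move=> b01; rewrite mule_ge0 ?log_gap_ge0 ?tilt_ge0// lee_fin invr_ge0 ltW//.
by case/andP: b01.
Qed.

Let measurable_log_gap_tilt b :
  measurable_fun setT (fun x => (b^-1)%:E * log_gap (tilt b x)).
Proof.
apply: measurable_funeM.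
exact: (measurableT_comp (@measurable_log_gap R) (measurable_tilt _)).
Qed.

(** Where [rho > 0], [ln (tilt b) = b * ln rho - ln (renyi_moment b)]; as [rho] and [tilt b] both
    have mean 1, the linear parts of the two gaps drop out. The identity also covers infinite
    [KL P0 P1]. *)
Lemma KL_renyi b : (0 < b <= 1)%R ->
  KL P0 P1 = (renyi b)%:E + \int[P0]_x ((b^-1)%:E * log_gap (tilt b x)).
Proof.
move=> b01; have /andP[b0 b1] := b01; have z0 := renyi_moment_gt0 b01.
have ptw x : log_gap (rho x) + (b^-1%:E * (tilt b x)%:E + 1) =
    ((b^-1 + renyi b)%:E + (rho x)%:E) + (b^-1)%:E * log_gap (tilt b x).
  have := rho_ge0 x; rewrite /tilt le_eqVlt => /predU1P[<-|r0].
    rewrite powR0 ?gt_eqF// mul0r log_gap0 gt0_muley ?lte_fin ?invr_gt0//.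
  rewrite !log_gap_EFin ?divr_gt0 ?powR_gt0//.
  rewrite ln_div ?posrE ?powR_gt0// ln_powR -!EFinM -!EFinD /renyi; congr _%:E.
  by field; rewrite !gt_eqF.
have tilt0 x : setT x -> 0 <= b^-1%:E * (tilt b x)%:E.
  by move=> _; rewrite -EFinM lee_fin mulr_ge0 ?tilt_ge0// invr_ge0 ltW.
have mtilt : measurable_fun setT (fun x => b^-1%:E * (tilt b x)%:E).
  apply: measurable_funeM.
  by apply/measurable_EFinP; exact: measurable_tilt.
have int_tilt : \int[P0]_x (b^-1%:E * (tilt b x)%:E + 1) = (b^-1)%:E + 1.
  rewrite ge0_integralD//; congr (_ + _); last exact: integral_cst_probability.
  rewrite ge0_integralZl ?integral_tilt ?mule1//.
  - by apply/measurable_EFinP; exact: measurable_tilt.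
  - by move=> x _; rewrite lee_fin tilt_ge0.
  - by rewrite lee_fin invr_ge0 ltW.
have bD0 : 0 <= (b^-1 + renyi b)%:E.
  by rewrite lee_fin addr_ge0 ?renyi_ge0// invr_ge0 ltW.
have int_rho : \int[P0]_x ((b^-1 + renyi b)%:E + (rho x)%:E) =
    (b^-1 + renyi b)%:E + 1.
  rewrite ge0_integralD//; congr (_ + _); first exact: integral_cst_probability.
  exact: integral_rho.
have eL : \int[P0]_x (log_gap (rho x) + (b^-1%:E * (tilt b x)%:E + 1)) =
    KL P0 P1 + ((b^-1)%:E + 1).
  rewrite KL_log_gap -int_tilt; apply: ge0_integralD => //.
  - by move=> x _; exact: log_gap_ge0 (rho_ge0 x).
  - exact: measurable_log_gap_rho.
  - by move=> x _; rewrite adde_ge0// tilt0.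
  - exact: emeasurable_funD.
have eR : \int[P0]_x (((b^-1 + renyi b)%:E + (rho x)%:E) +
      (b^-1)%:E * log_gap (tilt b x)) =
    ((b^-1 + renyi b)%:E + 1) + \int[P0]_x ((b^-1)%:E * log_gap (tilt b x)).
  rewrite -int_rho; apply: ge0_integralD => //.
  - by move=> x _; rewrite adde_ge0// rhoE_ge0.
  - exact: emeasurable_funD.
  - by move=> x _; exact: log_gap_tilt_ge0.
have : KL P0 P1 + ((b^-1)%:E + 1) = ((b^-1 + renyi b)%:E + 1) +
    \int[P0]_x ((b^-1)%:E * log_gap (tilt b x)).
  by rewrite -eL -eR; apply: eq_integral => x _; rewrite ptw.
move=> /(congr1 (fun u => u - (b^-1 + 1)%:E)); rewrite -EFinD addeK// => ->.
rewrite addeAC; congr (_ + _); rewrite -?EFinB -?EFinD -?EFinB; congr _%:E.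
by rewrite /=; lra.
Qed.

Lemma renyi_le_KL b : (0 < b <= 1)%R -> (renyi b)%:E <= KL P0 P1.
Proof.
move=> b01; rewrite (KL_renyi b01) leeDl// integral_ge0// => x _.
exact: log_gap_tilt_ge0.
Qed.

(* Equality forces the integrand of KL_renyi to vanish, i.e. rho `^ b to be
   almost surely constant. *)
Lemma renyi_lt_KL b : (0 < b <= 1)%R ->
  ~ (exists c : \bar R, {ae P0, forall x, lne (density P1 P0 x) = c}) ->
  (renyi b)%:E < KL P0 P1.
Proof.
move=> b01 nc; rewrite lt_neqAle renyi_le_KL// andbT; apply/negP => /eqP e.
have /andP[b0 b1] := b01; have z0 := renyi_moment_gt0 b01.
apply: nc; exists (b^-1 * ln (renyi_moment b))%:E.
have : \int[P0]_x `|(b^-1)%:E * log_gap (tilt b x)| = 0.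
  transitivity (\int[P0]_x ((b^-1)%:E * log_gap (tilt b x))).
    by apply: eq_integral => x _; rewrite gee0_abs// log_gap_tilt_ge0.
  move: e; rewrite (KL_renyi b01) => /(congr1 (fun u => u - (renyi b)%:E)).
  by rewrite addeAC -EFinB subrr add0e.
move=> /(ae_eq_integral_abs P0 measurableT (measurable_log_gap_tilt b)).
apply: filterS => x /(_ I) /= /eqP.
rewrite mule_eq0 eqe invr_eq0 gt_eqF//= => /eqP /(log_gap_eq0 (tilt_ge0 x b01)).
rewrite /tilt => e1.
have rb : (rho x `^ b = renyi_moment b)%R.
  by move/(congr1 ( *%R^~ (renyi_moment b))): e1; rewrite mul1r divfK// gt_eqF.
have r0 : (0 < rho x)%R by rewrite (gt0_powR b0 (rho_ge0 x))// rb.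
by rewrite density_rho lne_EFin// -rb ln_powR mulKf// gt_eqF.
Qed.

(** Monotonicity of power means: Bernoulli's inequality with exponent [b'/b] for [tilt b], whose
    mean is 1. *)
Lemma renyi_ninc b b' : (0 < b')%R -> (b' <= b)%R -> (b <= 1)%R ->
  (renyi b <= renyi b')%R.
Proof.
move=> b'0 b'b b1; have b0 : (0 < b)%R := lt_le_trans b'0 b'b.
have b01 : (0 < b <= 1)%R by rewrite b0.
have b'01 : (0 < b' <= 1)%R by rewrite b'0 (le_trans b'b).
have z0 := renyi_moment_gt0 b01; have z'0 := renyi_moment_gt0 b'01.
pose p := (b' / b)%R.
have p01 : (0 < p <= 1)%R by rewrite divr_gt0//= ler_pdivrMr// mul1r.
have /andP[p0 p1] := p01.
have zp0 : (0 < renyi_moment b `^ p)%R by rewrite powR_gt0.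
suff : (renyi_moment b' <= renyi_moment b `^ p)%R.
  rewrite -ler_ln ?posrE// ln_powR lerN2 => h.
  rewrite -(ler_pM2l b'0) mulrA divff ?gt_eqF// mul1r (le_trans h)//.
  by rewrite /p mulrA.
set c := (renyi_moment b `^ p)%R in zp0 *.
have tiltp x : (tilt b x `^ p = rho x `^ b' / c)%R.
  rewrite powRM ?powR_ge0 ?invr_ge0 ?ltW// -powRrM -powR_inv1 ?ltW//.
  by rewrite -powRrM mulN1r powRN /p mulrCA divff ?gt_eqF// mulr1.
have bern x : (rho x `^ b' <= c * (p * tilt b x + (1 - p)))%R.
  have := powR_bernoulli p01 (tilt_ge0 x b01).
  rewrite tiltp ler_pdivrMr// => /le_trans; apply.
  by rewrite mulrC ler_pM2l//; lra.
rewrite -lee_fin -integral_rho_powR//.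
have -> : c%:E = \int[P0]_x (c%:E * (p%:E * (tilt b x)%:E + (1 - p)%:E)).
  have mt : measurable_fun setT (fun x => (tilt b x)%:E).
    by apply/measurable_EFinP; exact: measurable_tilt.
  have t0 x : setT x -> 0 <= (tilt b x)%:E by rewrite lee_fin tilt_ge0.
  have pt0 x : setT x -> 0 <= p%:E * (tilt b x)%:E.
    by move=> _; rewrite mule_ge0 ?lee_fin ?tilt_ge0// ltW.
  have mpt : measurable_fun setT (fun x => p%:E * (tilt b x)%:E).
    exact: measurable_funeM.
  have q0 : 0 <= (1 - p)%:E by rewrite lee_fin subr_ge0.
  rewrite ge0_integralZl//; last 3 first.
  - exact: emeasurable_funD.
  - by move=> x _; rewrite adde_ge0// pt0.
  - by rewrite lee_fin ltW.
  rewrite ge0_integralD// ge0_integralZl// ?lee_fin ?ltW// integral_tilt//.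
  have -> : \int[P0]_x (1 - p)%:E = (1 - p)%:E by exact: integral_cst_probability.
  by rewrite mule1 -EFinD addrC subrK mule1.
apply: ge0_le_integral => //.
- by move=> x _; rewrite lee_fin powR_ge0.
- by apply/measurable_EFinP; exact: measurable_rho_powR.
- apply: measurable_funeM; apply: emeasurable_funD => //.
  by apply: measurable_funeM; apply/measurable_EFinP; exact: measurable_tilt.
- by move=> x _; rewrite -!EFinM -?EFinD -?EFinM lee_fin.
Qed.

End kl_renyi.

(** * The Renyi divergence as b tends to 0 *)

Section log_gap_approx.
Context (R : realType).
Implicit Types b y : R.

(** The difference quotient [(1 - y ^ b) / b] replaces [- ln y]. Adding [y - 1], which cancels it at
    [b = 1], makes the function nonnegative; it increases to [log_gap] as [b] decreases to 0. *)
Definition log_gap_approx b y : R := ((1 - y `^ b) / b + (y - 1))%R.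

Lemma log_gap_approx_ge0 b y : (0 < b <= 1)%R -> (0 <= y)%R ->
  (0 <= log_gap_approx b y)%R.
Proof.
move=> /andP[b0 b1] y0; have := powR_diff_quotient_ninc y0 b0 b1.
by rewrite powRr1// divr1 /log_gap_approx; lra.
Qed.

Lemma cvg_log_gap_approx y : (0 <= y)%R ->
  (log_gap_approx n.+1%:R^-1 y)%:E @[n --> \oo] --> log_gap y.
Proof.
rewrite le_eqVlt => /predU1P[<-|y0].
  rewrite log_gap0 /log_gap_approx.
  under eq_fun => n do
    rewrite powR0 ?invr_eq0 ?pnatr_eq0// subr0 invrK mul1r sub0r -natr1 addrK.
  exact/cvgeryP/cvgr_idn.
rewrite log_gap_EFin//; apply: cvg_EFin; first exact: nearW.
rewrite /log_gap_approx [X in _ --> X]addrC /comp /=.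
apply: cvgD; last exact: cvg_cst.
have powR1 : (y `^ n.+1%:R^-1 @[n --> \oo] --> (1 : R))%R.
  have -> : (fun n => y `^ n.+1%:R^-1)%R = (fun n => expR (n.+1%:R^-1 * ln y))%R.
    by apply/funext => n; rewrite /powR gt_eqF.
  rewrite -[X in _ --> X](@expR0 R); apply: continuous_cvg.
    exact: continuous_expR.
  rewrite -[X in _ --> X](mul0r (ln y)); apply: cvgM; last exact: cvg_cst.
  exact: cvg_harmonic.
apply: (@squeeze_cvgr _ _ _ _ (fun n => - (y `^ n.+1%:R^-1 * ln y))%R
  (fun=> - ln y)%R); last 2 first.
- rewrite -[X in _ --> X](congr1 -%R (mul1r (ln y))); apply: cvgN.
  by apply: cvgM; [exact: powR1|exact: cvg_cst].
- exact: cvg_cst.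
(* The inequality [ln u <= u - 1] at [u = y ^ (-b)] and at [u = y ^ b]. *)
have bounds b : (0 < b)%R ->
    (- (y `^ b * ln y) <= (1 - y `^ b) / b <= - ln y)%R.
  move=> b0; have yb0 : (0 < y `^ b)%R by rewrite powR_gt0.
  rewrite ler_pdivlMr// ler_pdivrMr//; apply/andP; split; last first.
    by have := ln_le_sub1 yb0; rewrite ln_powR; lra.
  have := ln_le_sub1 (powR_gt0 (- b) y0); rewrite ln_powR powRN.
  by rewrite -(ler_pM2l yb0) mulrBr divff ?gt_eqF// mulr1; lra.
by apply: nearW => n; apply: bounds; rewrite invr_gt0.
Qed.

End log_gap_approx.

Section kl_limit.
Context d (X : measurableType d) (R : realType).
Variables (P0 P1 : probability X R).
Hypothesis hac : P1 `<< P0.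

Let rho x : R := fine (density P1 P0 x).

Let rho0 x : (0 <= rho x)%R. Proof. exact: rho_ge0. Qed.

Let measurable_approx b :
  measurable_fun setT (fun x => (log_gap_approx b (rho x))%:E).
Proof.
apply/measurable_EFinP; apply: measurable_funD.
  apply: measurable_funM => //; apply: measurable_funB => //.
  exact: measurable_rho_powR.
by apply: measurable_funB => //; exact: measurable_rho.
Qed.

(** As [rho] has mean 1, the left side is [(1 - z) / b] with [z] the moment of order [b], and
    [ln z <= z - 1]. *)
Lemma integral_log_gap_approx_le b : (0 < b <= 1)%R ->
  \int[P0]_x (log_gap_approx b (rho x))%:E <= (renyi P0 P1 b)%:E.
Proof.
move=> b01; have /andP[b0 b1] := b01; have z0 := renyi_moment_gt0 hac b01.
set z := renyi_moment P0 P1 b in z0.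
have mrE : measurable_fun setT (fun x => (rho x)%:E).
  by apply/measurable_EFinP; exact: measurable_rho.
have mrb : measurable_fun setT (fun x => (rho x `^ b)%:E).
  by apply/measurable_EFinP; exact: measurable_rho_powR.
have rE0 x : setT x -> 0 <= (rho x)%:E by rewrite lee_fin.
have rb0 x : setT x -> 0 <= (rho x `^ b)%:E by rewrite lee_fin powR_ge0.
have ib0 : 0 <= (b^-1)%:E by rewrite lee_fin invr_ge0 ltW.
have brb0 x : setT x -> 0 <= b^-1%:E * (rho x `^ b)%:E.
  by move=> xT; rewrite mule_ge0// rb0.
have mbrb : measurable_fun setT (fun x => b^-1%:E * (rho x `^ b)%:E).
  exact: measurable_funeM.
have g0 x : setT x -> 0 <= (log_gap_approx b (rho x))%:E.
  by rewrite lee_fin log_gap_approx_ge0.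
have eL : \int[P0]_x ((log_gap_approx b (rho x))%:E +
      (b^-1%:E * (rho x `^ b)%:E + 1)) =
    \int[P0]_x (log_gap_approx b (rho x))%:E + ((b^-1 * z)%:E + 1).
  rewrite ge0_integralD//; last 2 first.
  - by move=> x xT; rewrite adde_ge0// brb0.
  - exact: emeasurable_funD.
  congr (_ + _); rewrite ge0_integralD//; congr (_ + _).
    by rewrite ge0_integralZl// integral_rho_powR.
  exact: integral_cst_probability.
have eR : \int[P0]_x ((b^-1)%:E + (rho x)%:E) = (b^-1)%:E + 1.
  rewrite ge0_integralD//; congr (_ + _); first exact: integral_cst_probability.
  exact: integral_rho.
have : \int[P0]_x (log_gap_approx b (rho x))%:E + ((b^-1 * z)%:E + 1) =
    (b^-1)%:E + 1.
  rewrite -eL -eR; apply: eq_integral => x _.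
  rewrite -EFinM -!EFinD; congr _%:E; rewrite /log_gap_approx; field.
  by rewrite gt_eqF.
rewrite -!EFinD => /(congr1 (fun u => u - (b^-1 * z + 1)%:E)); rewrite addeK// => ->.
rewrite -EFinB lee_fin /renyi -/z.
have := ln_le_sub1 z0; rewrite -(ler_pM2l (_ : (0 < b^-1)%R)) ?invr_gt0//.
lra.
Qed.

(** Monotonicity gives convergence to the supremum over [(0, 1]]. As [renyi] is the logarithm of an
    integral, monotone convergence is applied to its minorant, the integral of [log_gap_approx],
    along [b = 1/(n+1)]. *)
Lemma cvg_renyi : (renyi P0 P1 b)%:E @[b --> 0%R^'+] --> KL P0 P1.
Proof.
have := @nonincreasing_at_right_cvge R (fun b => (renyi P0 P1 b)%:E) 0%R
  (BRight 1%R).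
rewrite bnd_simp => /(_ ltr01).
set S := ereal_sup _ => hcvg.
suff <- : S = KL P0 P1.
  apply: hcvg => b' b; rewrite !in_itv/= => /andP[b'0 _] /andP[_ b1] b'b.
  by rewrite lee_fin renyi_ninc.
apply/eqP; rewrite eq_le; apply/andP; split.
  by apply: ge_ereal_sup => y [b]; rewrite /= in_itv => /= b01 <-; exact: renyi_le_KL.
have n01 n : (0 < (n.+1%:R^-1 : R) <= 1)%R.
  by rewrite invr_gt0 ltr0n invf_le1 ?ltr0n// ler1n.
rewrite KL_log_gap//.
have -> : \int[P0]_x log_gap (fine (density P1 P0 x)) =
    \int[P0]_x limn (fun n => (log_gap_approx n.+1%:R^-1 (rho x))%:E).
  by apply: eq_integral => x _; apply/esym/cvg_lim => //; exact: cvg_log_gap_approx.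
have mono x : setT x -> {homo (fun n => (log_gap_approx n.+1%:R^-1 (rho x))%:E) :
    n m / (n <= m)%N >-> n <= m}.
  move=> _ n m nm; rewrite lee_fin lerD2r powR_diff_quotient_ninc//.
  by rewrite lef_pV2 ?posrE// ler_nat ltnS.
apply: (cvge_le _ (cvg_monotone_convergence measurableT _ _ mono)) => //.
  apply: nearW => n; apply: (le_trans (integral_log_gap_approx_le (n01 n))).
  by apply: ereal_sup_ubound; exists (n.+1%:R^-1)%R => //=; rewrite in_itv/= n01.
by move=> n x _; rewrite lee_fin log_gap_approx_ge0.
Qed.

Lemma RbetaE b x : (0 < b <= 1)%R -> Rbeta P0 P1 b x = (tilt P0 P1 b x)%:E.
Proof.
move=> b01; rewrite /Rbeta ZbetaE// density_rho// poweR_EFin.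
by rewrite inver gt_eqF ?renyi_moment_gt0// -EFinM.
Qed.

Lemma Rbeta_evariable b : (0 < b <= 1)%R -> evariables P0 (Rbeta P0 P1 b).
Proof.
move=> b01; have -> : Rbeta P0 P1 b = EFin \o tilt P0 P1 b.
  by apply/funext => x; exact: RbetaE.
split.
- by apply/measurable_EFinP; exact: measurable_tilt.
- by move=> x; rewrite lee_fin tilt_ge0.
- by rewrite integral_tilt.
Qed.

(** For [s = (1-b)/b], the product of [Rbeta ^ (-s)] and [rho] is [z ^ s * rho ^ b], so the moment
    is [z ^ (s + 1)], that is [z ^ (1/b)]: equality in Holder's bound. *)
Lemma neg_log_moment_Rbeta b : (0 < b <= 1)%R ->
  neg_log_moment P1 (Rbeta P0 P1 b) ((1 - b) / b) = (renyi P0 P1 b)%:E.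
Proof.
move=> b01; have /andP[b0 b1] := b01; have z0 := renyi_moment_gt0 hac b01.
set z := renyi_moment P0 P1 b in z0; set s := ((1 - b) / b)%R.
have s0 : (0 <= s)%R by rewrite divr_ge0// ?subr_ge0// ltW.
have zs0 : (0 < z `^ s)%R by rewrite powR_gt0.
have bs : (b * s = 1 - b)%R by rewrite mulrC divfK// gt_eqF.
rewrite /neg_log_moment.
have -> : \int[P1]_x (Rbeta P0 P1 b x `^ s)^-1 = (z `^ s * z)%:E.
  rewrite -(integral_density_mul hac); last 2 first.
  - apply: (measurableT_comp (@measurable_inve R)).
    apply: (measurableT_comp (measurable_poweR _)).
    by have [] := Rbeta_evariable b01.
  - by move=> x; rewrite inve_ge0 poweR_ge0.
  transitivity (\int[P0]_x ((z `^ s)%:E * (rho x `^ b)%:E)).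
    apply: eq_integral => x _; rewrite RbetaE// density_rho// poweR_EFin.
    rewrite -/(rho x) /tilt -/(rho x) -/z.
    (* Where [rho = 0], the factor [rho] annihilates the possibly infinite inverse, as
       [+oo * 0 = 0]. *)
    have := rho0 x; rewrite le_eqVlt => /predU1P[<-|r0].
      by rewrite mule0 powR0 ?gt_eqF// mule0.
    rewrite inver gt_eqF ?powR_gt0 ?divr_gt0 ?powR_gt0//.
    rewrite -!EFinM; congr _%:E.
    rewrite powRM ?powR_ge0 ?invr_ge0 ?ltW// -powRrM bs invfM.
    rewrite -[(z^-1)%R]powR_inv1 ?ltW// -powRrM mulN1r powRN invrK mulrAC mulrC.
    congr (_ * _)%R; rewrite -powRN opprB -{2}(powRr1 (ltW r0)) -powRD ?subrK//.
    by rewrite (gt_eqF r0) implybT.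
  rewrite ge0_integralZl//.
  - by rewrite integral_rho_powR// -EFinM.
  - by apply/measurable_EFinP; exact: measurable_rho_powR.
  - by move=> x _; rewrite lee_fin powR_ge0.
  - by rewrite lee_fin ltW.
rewrite lne_EFin ?mulr_gt0// lnM ?posrE// ln_powR -EFinN; congr _%:E.
by rewrite /renyi -/z /s; field; rewrite gt_eqF.
Qed.

End kl_limit.

(** * Upper bound on the exponents *)

Section pointwise.
Context (R : realType).
Implicit Types (b c s x : R) (W : \bar R).

(* Weighted AM-GM for c * x * W^{-s} and W with weights b and 1 - b: as
   s * b = 1 - b, the powers of W cancel in the geometric mean. *)
Lemma bet_wamgm s c x W (b := (1 + s)^-1%R) :
  (0 <= s)%R -> (0 < c)%R -> (0 <= x)%R -> 0 <= W ->
  ((c * x) `^ b)%:E <= (b * c)%:E * ((W `^ s)^-1 * x%:E) + (1 - b)%:E * W.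
Proof.
move=> s0 c0 x0 W0; have s1 : (0 < 1 + s)%R by rewrite ltr_wpDr.
have b0 : (0 < b)%R by rewrite invr_gt0.
have b1 : (b <= 1)%R by rewrite invf_le1// lerDl.
have b01 : (0 < b <= 1)%R by rewrite b0.
have bc0 : (0 < b * c)%R by rewrite mulr_gt0.
have sb : (s * b = 1 - b)%R by rewrite /b; field; rewrite gt_eqF.
have cx0 : (0 <= c * x)%R by rewrite mulr_ge0// ltW.
have rhs0 : 0 <= (b * c)%:E * ((W `^ s)^-1 * x%:E).
  apply: mule_ge0; first by rewrite lee_fin ltW.
  by apply: mule_ge0 => //; rewrite inve_ge0 poweR_ge0.
move: s0; rewrite le_eqVlt => /predU1P[s0|s0].
  have -> : b = 1%R by rewrite /b -s0 addr0 invr1.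
  rewrite powRr1// subrr mul0e adde0 mul1r -s0 poweRe0 inve1 mul1e -EFinM.
  exact: lexx.
have b1' : (0 < 1 - b)%R by rewrite -sb mulr_gt0.
case: W W0 rhs0 => [w| |] // w0 rhs0; last first.
  by rewrite gt0_muley ?lte_fin// addey ?leey// gt_eqF// (lt_le_trans _ rhs0).
move: w0; rewrite lee_fin le_eqVlt => /predU1P[w0|w0].
  rewrite -w0 mule0 adde0 poweR_EFin powR0 ?gt_eqF// inve0.
  move: x0; rewrite le_eqVlt => /predU1P[<-|x0].
    by rewrite mulr0 powR0 ?gt_eqF// !mule0.
  by rewrite gt0_mulye ?lte_fin// gt0_muley ?lte_fin// leey.
have ws0 : (0 < w `^ s)%R by rewrite powR_gt0.
rewrite poweR_EFin inver gt_eqF// -!EFinM -EFinD lee_fin.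
have y0 : (0 <= c * x * w `^ (- s))%R by rewrite mulr_ge0 ?powR_ge0.
have := powR_wamgm b01 y0 (ltW w0).
rewrite powRM ?powR_ge0// -powRrM mulNr sb -mulrA -powRD ?(gt_eqF w0) ?implybT//.
by rewrite addNr powRr0 mulr1 powRN => /le_trans; apply; lra.
Qed.

End pointwise.

Section main_bound.
Context d (X : measurableType d) (R : realType).
Variables (P0 P1 : probability X R) (PP0 PP1 : probability (seq_space X) R).
Hypotheses (hPP0 : is_iid_law P0 PP0) (hPP1 : is_iid_law P1 PP1).
Hypothesis hac : P1 `<< P0.

(** In the integral of [bet_wamgm] under [PP0], the left side has mean 1 and the last term mean at
    most [1 - b]. This leaves [1 <= b * c * M + (1 - b)], that is [c * M >= 1], for the moment
    [M]. *)
Lemma moment_lower_bound t (W : seq_space X -> \bar R) s :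
  measurable_wrt (@filt _ X t) W -> (forall w, 0 <= W w) ->
  \int[PP0]_w W w <= 1 -> (0 <= s)%R ->
  (renyi_moment P0 P1 (1 + s)^-1 `^ (t%:R * (1 + s)))%:E <=
    \int[PP1]_w (W w `^ s)^-1.
Proof.
move=> mW W0 W1 s0; set b := ((1 + s)^-1)%R.
have s1 : (0 < 1 + s)%R by rewrite ltr_wpDr.
have b0 : (0 < b)%R by rewrite invr_gt0.
have b1 : (b <= 1)%R by rewrite invf_le1// lerDl.
have b01 : (0 < b <= 1)%R by rewrite b0.
have z0 := renyi_moment_gt0 hac b01.
set z := renyi_moment P0 P1 b in z0 *.
(* By independence the mean of [(c * R_t) ^ b] is [c ^ b * z ^ t]; this [c] makes it 1. *)
pose c := (z `^ (- (t%:R * (1 + s))))%R.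
have c0 : (0 < c)%R by rewrite powR_gt0.
have bc0 : (0 < b * c)%R by rewrite mulr_gt0.
have q0 : (0 <= 1 - b)%R by rewrite subr_ge0.
have mW' := measurable_wrt_measurable mW.
have mM : measurable_wrt (@filt _ X t) (fun w => (W w `^ s)^-1).
  exact: measurable_inve_poweR.
have mM' := measurable_wrt_measurable mM.
have M0 w : 0 <= (W w `^ s)^-1 by rewrite inve_ge0 poweR_ge0.
have mD := measurable_wrt_measurable (@measurable_wrt_density_prod _ _ _ _ _ hac t).
have D0 w := density_prod_ge0 hac t w.
pose x (w : seq_space X) : R := fine (density_prod P1 P0 t w).
have xE w : density_prod P1 P0 t w = (x w)%:E.
  by rewrite fineK// prode_fin_num// => k _; exact: density_fin_num.
have x0 w : (0 <= x w)%R by rewrite fine_ge0.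
have mx : measurable_fun setT x.
  exact: (measurableT_comp (fine_measurable _) mD).
have key : \int[PP0]_w ((c * x w) `^ b)%:E <=
    \int[PP0]_w ((b * c)%:E * ((W w `^ s)^-1 * (x w)%:E) + (1 - b)%:E * W w).
  apply: ge0_le_integral => //.
  - by move=> w _; rewrite lee_fin powR_ge0.
  - apply/measurable_EFinP; apply: (measurableT_comp (measurable_powR b)).
    exact: measurable_funM.
  - apply: emeasurable_funD; last exact: measurable_funeM.
    apply: measurable_funeM; apply: emeasurable_funM => //.
    exact/measurable_EFinP.
  - by move=> w _; exact: bet_wamgm.
have lhs : \int[PP0]_w ((c * x w) `^ b)%:E = 1.
  transitivity (\int[PP0]_w ((c `^ b)%:E *
      \prod_(k < t) (fine (density P1 P0 (w k)) `^ b)%:E)).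
    apply: eq_integral => w _; rewrite (powRM _ (ltW c0) (x0 w)) EFinM.
    congr (_ * _).
    rewrite -poweR_EFin -xE /density_prod.
    elim: t {mW mM mM' mD D0 x xE x0 mx key c c0 bc0} => [|n IH].
      by rewrite !big_ord0 poweR1r.
    rewrite !big_ord_recr /= poweRM ?density_ge0//; last first.
      by apply: prode_ge0 => k _; exact: density_ge0.
    by rewrite IH density_rho.
  have f0 (k : nat) y : 0 <= (fine (density P1 P0 y) `^ b)%:E.
    by rewrite lee_fin powR_ge0.
  have mf (k : nat) : measurable_fun setT
      (fun y => (fine (density P1 P0 y) `^ b)%:E).
    by apply/measurable_EFinP; exact: measurable_rho_powR.
  rewrite ge0_integralZl//; last 3 first.
  - have := @emeasurable_prod_ord _ (seq_space X) R setT t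
      (fun k w => (fine (density P1 P0 (w k)) `^ b)%:E).
    apply=> k _; exact: (measurableT_comp (mf k) (@measurable_coord _ X k)).
  - by move=> w _; apply: prode_ge0 => k _; exact: f0.
  - by rewrite lee_fin powR_ge0.
  have -> : \int[PP0]_w (\prod_(k < t) (fine (density P1 P0 (w k)) `^ b)%:E) =
      \prod_(k < t) \int[P0]_y (fine (density P1 P0 y) `^ b)%:E.
    exact: (iid_integral_prod hPP0 t mf f0).
  rewrite (eq_bigr (fun=> z%:E)); last by move=> k _; rewrite integral_rho_powR.
  have -> : \prod_(k < t) z%:E = (z `^ t%:R)%:E.
    rewrite powR_mulrn ?ltW//; elim: (t) => [|n IH]; first by rewrite big_ord0.
    by rewrite big_ord_recr /= IH exprSr EFinM.
  rewrite -EFinM /c -powRrM -powRD ?(gt_eqF z0) ?implybT//.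
  by rewrite mulNr -mulrA divff ?gt_eqF// mulr1 addNr powRr0.
have rhs : \int[PP0]_w ((b * c)%:E * ((W w `^ s)^-1 * (x w)%:E) + (1 - b)%:E * W w)
    = (b * c)%:E * \int[PP1]_w (W w `^ s)^-1 + (1 - b)%:E * \int[PP0]_w W w.
  have mMx : measurable_fun setT (fun w => (W w `^ s)^-1 * (x w)%:E).
    by apply: emeasurable_funM => //; exact/measurable_EFinP.
  have Mx0 w : setT w -> 0 <= (W w `^ s)^-1 * (x w)%:E.
    by move=> _; rewrite mule_ge0// lee_fin.
  rewrite ge0_integralD//; last 4 first.
  - by move=> w wT; rewrite mule_ge0 ?Mx0// lee_fin ltW.
  - exact: measurable_funeM.
  - by move=> w _; rewrite mule_ge0.
  - exact: measurable_funeM.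
  rewrite ge0_integralZl ?lee_fin ?ltW// ge0_integralZl ?lee_fin//.
  congr (_ * _ + _).
  rewrite -(integral_density_prod hac hPP1 hPP0 mM M0).
  by apply: eq_integral => w _; rewrite xE.
move: key; rewrite lhs rhs => key.
have : 1 <= (b * c)%:E * \int[PP1]_w (W w `^ s)^-1 + (1 - b)%:E.
  apply: (le_trans key); rewrite leeD2l// -[leRHS]mule1.
  by rewrite lee_wpmul2l// lee_fin.
have : 0 <= \int[PP1]_w (W w `^ s)^-1 by exact: integral_ge0.
case: (\int[PP1]_w (W w `^ s)^-1) => [m| |] // m0; last by rewrite leey.
rewrite -EFinM -EFinD !lee_fin => h.
have : (1 <= c * m)%R by rewrite -(ler_pM2l b0) mulr1; lra.
have -> : (z `^ (t%:R * (1 + s)) = c^-1)%R by rewrite /c powRN invrK.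
by move=> cm; rewrite -(ler_pM2l c0) divff ?gt_eqF.
Qed.

Lemma Lambda_ts_le_renyi (B : nat -> seq_space X -> \bar R) s t :
  betting PP0 B -> (0 <= s)%R -> (0 < t)%N ->
  Lambda_ts PP1 B t s <= (renyi P0 P1 (1 + s)^-1)%:E.
Proof.
move=> hB s0 t0; have s1 : (0 < 1 + s)%R by rewrite ltr_wpDr.
have b01 : (0 < (1 + s)^-1 <= 1)%R by rewrite invr_gt0 s1 invf_le1// lerDl.
have z0 := renyi_moment_gt0 hac b01.
have := moment_lower_bound (@measurable_wrt_wealth _ _ _ _ _ hB t)
  (wealth_ge0 hB t) (integral_wealth_le1 hB t) s0.
rewrite /Lambda_ts /neg_log_moment.
set M := \int[PP1]_w _ => hM.
have tR : (0 < t%:R :> R)%R by rewrite ltr0n.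
have zt0 : (0 < renyi_moment P0 P1 (1 + s)^-1 `^ (t%:R * (1 + s)))%R.
  by rewrite powR_gt0.
have -> : (renyi P0 P1 (1 + s)^-1)%:E = (t%:R^-1)%:E *
    - lne (renyi_moment P0 P1 (1 + s)^-1 `^ (t%:R * (1 + s)))%:E.
  rewrite lne_EFin// ln_powR -EFinN -EFinM /renyi invrK; congr _%:E.
  by field; rewrite gt_eqF.
rewrite lee_pmul2l ?lte_fin ?invr_gt0// leeN2 lee_lne// in_itv/= leey andbT.
  by rewrite lee_fin ltW.
by rewrite (le_trans _ hM)// lee_fin ltW.
Qed.

Lemma Lambda_ts_le_KL (B : nat -> seq_space X -> \bar R) s t :
  betting PP0 B -> (0 <= s)%R -> (0 < t)%N -> Lambda_ts PP1 B t s <= KL P0 P1.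
Proof.
move=> hB s0 t0; apply: (le_trans (Lambda_ts_le_renyi hB s0 t0)).
have s1 : (0 < 1 + s)%R by rewrite ltr_wpDr.
by apply: renyi_le_KL => //; rewrite invr_gt0 s1 invf_le1// lerDl.
Qed.

End main_bound.

(** * Betting with a single e-variable, error bounds, non-attainment *)

Section iid_betting.
Context d (X : measurableType d) (R : realType).
Variables (P0 P1 : probability X R) (PP0 PP1 : probability (seq_space X) R).
Hypotheses (hPP0 : is_iid_law P0 PP0) (hPP1 : is_iid_law P1 PP1).
Hypothesis hac : P1 `<< P0.

Lemma evariable_betting (E : X -> \bar R) : evariables P0 E ->
  betting PP0 (fun n (w : seq_space X) => E (w n)).
Proof.
move=> [mE E0 E1] n; split=> //.
  exact: (measurableT_comp mE (measurable_wrt_coord (ltnSn n))).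
exists (cst (\int[P0]_x E x)); split; last exact: aeW.
split=> [||A FA]; first exact: measurable_cst.
  by move=> w; exact: integral_ge0.
have mA := filt_measurable FA.
rewrite integral_cst// muleC; apply/esym; exact: iid_integral_filt.
Qed.

(** Finiteness makes the inverse power multiplicative: for [s > 0], the product [0 * +oo] is 0, with
    inverse power [+oo], while the product of the inverse powers is 0. Integrability gives
    finiteness under [P0], and domination carries it to [P1]. *)
Lemma evariable_lty (E : X -> \bar R) : evariables P0 E ->
  {ae PP1, forall w : seq_space X, forall k, E (w k) < +oo}.
Proof.
move=> [mE E0 E1]; apply: ae_foralln => k.
pose N := [set x | +oo <= E x].
have mN : measurable N.
  by rewrite -[N]setTI; exact: emeasurable_fun_c_infty.
have iE : P0.-integrable setT E.
  apply/integrableP; split => //.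
  apply: (le_lt_trans _ (ltry 1)); apply: le_trans E1.
  by under eq_integral do rewrite gee0_abs//.
have P0N : P0 N = 0.
  apply: measure_negligible => //.
  have := integrable_ae measurableT iE; apply: negligibleS => x /=.
  by rewrite /N /= leye_eq => /eqP -> /(_ I).
have P1N : P1 N = 0 by move/null_content_dominatesP : hac; exact.
exists [set w : seq_space X | N (w k)]; split.
- by apply: (@filt_measurable _ _ k.+1); exact: filt_coord.
- exact: (iid_coord_null hPP1 k mN P1N).
- by move=> w /= /negP; rewrite -leNgt.
Qed.

Lemma Lambda_ts_iid (B : nat -> seq_space X -> \bar R) (E : X -> \bar R) s t :
  evariables P0 E -> (forall n (w : seq_space X), B n w = E (w n)) ->
  (0 < t)%N -> Lambda_ts PP1 B t s = neg_log_moment P1 E s.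
Proof.
move=> hE BE t0; have [mE E0 E1] := hE.
have mEs : measurable_fun setT (fun x => (E x `^ s)^-1).
  exact: measurable_inve_poweR.
have Es0 x : 0 <= (E x `^ s)^-1 by rewrite inve_ge0 poweR_ge0.
have mB (k : nat) : measurable_fun [set: seq_space X] (B k).
  have -> : B k = fun w : seq_space X => E (w k).
    by apply/funext => w; exact: BE.
  exact: (measurableT_comp mE (@measurable_coord _ X k)).
have eW : \int[PP1]_w (wealth B t w `^ s)^-1 =
    \prod_(k < t) \int[P1]_x (E x `^ s)^-1.
  transitivity (\int[PP1]_w \prod_(k < t) (E (w k) `^ s)^-1); last first.
    exact: (iid_integral_prod hPP1 t (fun=> mEs) (fun=> Es0)).
  apply: ge0_ae_eq_integral => //.
  - apply: measurable_inve_poweR.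
    exact: (@emeasurable_prod_ord _ (seq_space X) R setT t B).
  - apply: (@emeasurable_prod_ord _ (seq_space X) R setT t
      (fun k w => (E (w k) `^ s)^-1)) => k _.
    exact: (measurableT_comp mEs (@measurable_coord _ X k)).
  - by move=> w _; rewrite inve_ge0 poweR_ge0.
  - by move=> w _; apply: prode_ge0 => k _; exact: Es0.
  have := evariable_lty hE; apply: filterS => w Ew _.
  rewrite /wealth; elim: (t) => [|n IH].
    by rewrite !big_ord0 poweR1r inve1.
  rewrite !big_ord_recr /= -IH BE.
  have W0 : 0 <= \prod_(k < n) B k w.
    by apply: prode_ge0 => k _; rewrite BE.
  have Wfin : \prod_(k < n) B k w \is a fin_num.
    by apply: prode_fin_num => k _; rewrite BE ge0_fin_numE.
  rewrite poweRM// inveM// inveM_defE !poweR_ge0 !poweR_lty//.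
    rewrite !implybT /= !gee0_abs ?poweR_ge0//.
    rewrite (lt_eqF (poweR_lty _ _)); last by rewrite -ge0_fin_numE.
    by rewrite (lt_eqF (poweR_lty _ _)).
  by rewrite -ge0_fin_numE.
rewrite /Lambda_ts /neg_log_moment eW lne_prod_const ?integral_ge0//.
rewrite -muleN muleA -EFinM mulVf ?mul1e// pnatr_eq0.
by rewrite -lt0n.
Qed.

Lemma Lambda_t_iid (B : nat -> seq_space X -> \bar R) (E : X -> \bar R) t :
  evariables P0 E -> (forall n (w : seq_space X), B n w = E (w n)) ->
  (0 < t)%N -> Lambda_t PP1 B t = Lambda P1 E.
Proof.
move=> hE BE t0; congr ereal_sup; apply: eq_imagel => s _.
exact: Lambda_ts_iid.
Qed.

End iid_betting.

Section error_bounds.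
Context d (X : measurableType d) (R : realType).
Variables (PP0 PP1 : probability (seq_space X) R).
Variable B : nat -> seq_space X -> \bar R.
Hypothesis hB : betting PP0 B.

Let mW t : measurable_fun [set: seq_space X] (wealth B t).
Proof. exact: measurable_wrt_measurable (@measurable_wrt_wealth _ _ _ _ _ hB t). Qed.

Lemma measurable_wealth_le t c :
  @measurable _ (seq_space X) [set w | wealth B t w <= c].
Proof.
by rewrite -[X in measurable X]setTI; exact: emeasurable_fun_infty_c.
Qed.

Lemma lt_tau (alpha : R) t : [set w | (t%:R)%:E < tau B alpha w] =
  \bigcap_(j in [set j | (0 < j <= t)%N]) [set w | wealth B j w <= (alpha^-1)%:E].
Proof.
apply/seteqP; split => w /=.
  move=> tw j /= /andP[j0 jt]; rewrite leNgt; apply/negP => h.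
  suff : tau B alpha w <= (t%:R)%:E by rewrite leNgt tw.
  apply: (@le_trans _ _ (j%:R)%:E); last by rewrite lee_fin ler_nat.
  by apply: ereal_inf_lbound; exists j.
(* [tau] is an infimum of integers; bounding it below by [t + 1] keeps the inequality with [t]
   strict. *)
move=> h; apply: (@lt_le_trans _ _ (t.+1%:R)%:E).
  by rewrite lte_fin ltr_nat.
apply: le_ereal_inf_tmp => _ [j [j0 hj] <-]; rewrite lee_fin ler_nat ltnNge.
by apply/negP => jt; have := h j; rewrite /= j0 jt leNgt hj => /(_ isT).
Qed.

Lemma gammabar_le_gamma (alpha : R) t : (0 < t)%N ->
  gammabar_t PP1 B t alpha <= gamma_t PP1 B t alpha.
Proof.
move=> t0; rewrite /gammabar_t lt_tau; apply: le_measure.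
- rewrite inE; apply: bigcap_measurable => [|j _]; last exact: measurable_wealth_le.
  by exists t; rewrite /= t0 leqnn.
- by rewrite inE; exact: measurable_wealth_le.
- by move=> w /(_ t); apply; rewrite /= t0 leqnn.
Qed.

(** Chernoff's bound: [t] cancels the [1/t] in [Lambda_ts], so the exponential is [(1/alpha) ^ s]
    times the moment, even an infinite one, and its integrand dominates the indicator. *)
Lemma gamma_le_expeR (alpha : R) t (s : R) :
  (0 < alpha < 1)%R -> (0 < t)%N -> (0 <= s)%R ->
  gamma_t PP1 B t alpha
    <= expeR ((s * ln alpha^-1)%:E - t%:R%:E * Lambda_ts PP1 B t s).
Proof.
move=> /andP[a0 _] t0 s0; set a : R := (alpha^-1)%R.
have a'0 : (0 < a)%R by rewrite invr_gt0.
have M0 w : 0 <= (wealth B t w `^ s)^-1 by rewrite inve_ge0 poweR_ge0.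
have mM : measurable_fun [set: seq_space X] (fun w => (wealth B t w `^ s)^-1).
  exact: measurable_inve_poweR.
rewrite /Lambda_ts muleA -EFinM divff ?pnatr_eq0 -?lt0n// mul1e.
rewrite /neg_log_moment oppeK expeRD lneK; last first.
  by rewrite in_itv/= leey andbT integral_ge0.
have -> : expeR (s * ln a)%:E = (a `^ s)%:E by rewrite /powR gt_eqF.
rewrite -ge0_integralZl//; last by rewrite lee_fin powR_ge0.
pose A := [set w | wealth B t w <= a%:E].
have mA : @measurable _ (seq_space X) A by exact: measurable_wealth_le.
have -> : gamma_t PP1 B t alpha =
    \int[PP1]_w (\1_A w)%:E.
  by rewrite integral_indic// setIT.
have aM0 w : 0 <= (a `^ s)%:E * (wealth B t w `^ s)^-1.
  by rewrite mule_ge0// lee_fin powR_ge0.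
apply: ge0_le_integral => //.
- by apply/measurable_EFinP; exact: measurable_indic.
- exact: measurable_funeM.
- move=> w _; rewrite indicE.
  case: (boolP (w \in A)) => [/set_mem /= wa|_]; last exact: aM0.
  by apply: inve_powR_ge1 => //; exact: wealth_ge0 hB _ _.
Qed.

End error_bounds.

Lemma integral0_null d (T : measurableType d) (R : realType)
    (mu : {measure set T -> \bar R}) (f : T -> \bar R) (A : set T) :
  measurable_fun setT f -> (forall x, 0 <= f x) -> \int[mu]_x f x = 0 ->
  measurable A -> (forall x, A x -> 0 < f x) -> mu A = 0.
Proof.
move=> mf f0 intf mA fA; apply: measure_negligible => //.
have : \int[mu]_x `|f x| = 0.
  by rewrite -[RHS]intf; apply: eq_integral => x _; rewrite gee0_abs.
move=> /(ae_eq_integral_abs mu measurableT mf).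
apply: negligibleS => x Ax /(_ I) fx0.
by have := fA x Ax; rewrite fx0 ltxx.
Qed.

(** The laws are compared on [F_t] only, where [density_prod Q P t] is a density; on the whole
    sequence space the product laws of different [P] and [Q] are mutually singular. *)
Lemma iid_law_dominates d (X : measurableType d) (R : realType)
    (Q P : probability X R) (QQ PP : probability (seq_space X) R) t
    (A : set (seq_space X)) :
  is_iid_law Q QQ -> is_iid_law P PP -> Q `<< P ->
  @filt _ X t A -> PP A = 0 -> QQ A = 0.
Proof.
move=> hQQ hPP dom FA A0; have mA := filt_measurable FA.
pose Y (w : seq_space X) : \bar R := (\1_A w)%:E.
have mY : measurable_wrt (@filt _ X t) Y.
  apply/measurable_EFinP; apply: measurable_indic.
  by rewrite measurable_filt.
have mY' := measurable_wrt_measurable mY.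
have Y0 w : 0 <= Y w by rewrite lee_fin.
have := integral_density_prod dom hQQ hPP mY Y0.
have -> : \int[QQ]_w Y w = QQ A by rewrite integral_indic// setIT.
move=> <-.
have mD := measurable_wrt_measurable (@measurable_wrt_density_prod _ _ _ _ _ dom t).
have D0 w := density_prod_ge0 dom t w.
transitivity (\int[PP]_w (density_prod Q P t \_ A) w).
  by apply: eq_integral => w _; rewrite /Y epatch_indic muleC.
rewrite -integral_mkcond; apply: null_set_integral => //.
exact: measurable_funTS.
Qed.

Section not_attained.
Context d (X : measurableType d) (R : realType).
Variables (P0 P1 : probability X R) (PP0 PP1 : probability (seq_space X) R).
Hypotheses (hPP0 : is_iid_law P0 PP0) (hPP1 : is_iid_law P1 PP1).
Hypotheses (hac : P1 `<< P0) (dom : P0 `<< P1).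

Lemma eventually_moment_ge1 (B : nat -> seq_space X -> \bar R) t :
  betting PP0 B ->
  exists2 S : R, (0 <= S)%R &
    forall s, (S <= s)%R -> 1 <= \int[PP1]_w (wealth B t w `^ s)^-1.
Proof.
move=> hB.
have mWt := @measurable_wrt_wealth _ _ _ _ _ hB t.
have mW := measurable_wrt_measurable mWt.
have W0 w := wealth_ge0 hB t w.
have W1 := integral_wealth_le1 hB t.
set W := wealth B t in mWt mW W0 W1 *.
have m1 (f : seq_space X -> \bar R) : measurable_fun setT f ->
    measurable_fun setT (fun w => maxe (f w) 0).
  by move=> mf; exact: measurable_maxe.
have mv : measurable_fun setT (fun w => maxe (1 - W w) 0).
  by apply: m1; apply: emeasurable_funB.
have v0 w : 0 <= maxe (1 - W w) 0 by rewrite le_max lexx orbT.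
have mM s : measurable_fun setT (fun w => (W w `^ s)^-1).
  exact: measurable_inve_poweR.
have [e0|e0] := eqVneq (\int[PP1]_w maxe (1 - W w) 0) 0; last first.
  have : 0 < \int[PP1]_w maxe (1 - W w) 0.
    by rewrite lt0e e0 integral_ge0.
  have : \int[PP1]_w maxe (1 - W w) 0 <= 1.
    rewrite -[leRHS](integral_cst_probability PP1); apply: ge0_le_integral => //.
    move=> w _; rewrite ge_max lee01 andbT -[leRHS]sube0 leeB//.
  case e: (\int[PP1]_w maxe (1 - W w) 0) => [r| |] // _; rewrite lte_fin => r0.
  (* [r] is the mean of the positive part of [1 - W]; the tangent bound makes the moment at least
     [s * r]. *)
  exists r^-1%R; first by rewrite invr_ge0 ltW.
  move=> s rs; have s0 : (0 <= s)%R by rewrite (le_trans _ rs)// invr_ge0 ltW.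
  apply: (@le_trans _ _ (\int[PP1]_w (s%:E * maxe (1 - W w) 0))).
    rewrite ge0_integralZl// ?lee_fin// e -EFinM lee_fin.
    by rewrite -ler_pdivrMr// mul1r.
  apply: ge0_le_integral => //.
  - by move=> w _; rewrite mule_ge0.
  - exact: measurable_funeM.
  - by move=> w _; exact: inve_poweR_tangent.
(* The null event [W < 1] passes from [PP1] to [PP0], where the mean of [W] is controlled, and the
   null event [1 < W] passes back; each direction uses one of the two dominations. *)
exists 0%R => // s s0.
pose A := [set w | W w < 1]; pose A' := [set w | 1 < W w].
have FA : @filt _ X t A.
  rewrite -measurable_filt -[A]setTI.
  exact: (emeasurable_fun_infty_o measurableT mWt).
have FA' : @filt _ X t A'.
  rewrite -measurable_filt -[A']setTI.
  exact: (emeasurable_fun_o_infty measurableT mWt).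
have PP1A : PP1 A = 0.
  apply: (integral0_null mv v0 e0); first exact: filt_measurable FA.
  by move=> w Aw; rewrite lt_max sube_gt0 Aw.
have PP0A : PP0 A = 0 by exact: iid_law_dominates hPP0 hPP1 dom FA PP1A.
pose v' w := maxe (W w - 1) 0.
have mv' : measurable_fun setT v' by apply: m1; apply: emeasurable_funB.
have v'0 w : 0 <= v' w by rewrite le_max lexx orbT.
have intv' : \int[PP0]_w v' w = 0.
  apply/eqP; rewrite eq_le integral_ge0 ?andbT//.
  (* Off [A], [v' + 1] equals [W], whose mean is at most 1. *)
  rewrite -(@leeD2rE _ 1)// add0e; apply: le_trans W1.
  have -> : \int[PP0]_w v' w + 1 = \int[PP0]_w (v' w + cst 1 w).
    by rewrite ge0_integralD// integral_cst_probability.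
  apply: ae_ge0_le_integral => //.
  - by move=> w _; rewrite adde_ge0.
  - exact: emeasurable_funD.
  exists A; split=> //; first exact: filt_measurable FA.
  move=> w /= h; rewrite /A /= ltNge; apply/negP => W1w; apply: h => _.
  by rewrite /v' max_l ?sube_ge0// subeK.
have PP0A' : PP0 A' = 0.
  apply: (integral0_null mv' v'0 intv'); first exact: filt_measurable FA'.
  by move=> w Aw; rewrite lt_max sube_gt0 Aw.
have PP1A' : PP1 A' = 0 by exact: iid_law_dominates hPP1 hPP0 hac FA' PP0A'.
rewrite -[leLHS](integral_cst_probability PP1).
apply: ae_ge0_le_integral => //.
- by move=> w _; rewrite inve_ge0 poweR_ge0.
exists A'; split=> //; first exact: filt_measurable FA'.
move=> w /= h; rewrite /A' /= ltNge; apply/negP => Ww1; apply: h => _.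
have := inve_powR_ge1 ltr01 s0 (W0 w) Ww1.
by rewrite powR1 mul1e.
Qed.

(** The divergence at [b = 1/(1+S)], one number strictly below [KL P0 P1], bounds the exponent for
    all [s]: below [S] by [renyi_ninc], from [S] on because the exponent is then at most 0. *)
Lemma Lambda_t_lt_KL (B : nat -> seq_space X -> \bar R) t :
  ~ (exists c : \bar R, {ae P0, forall x, lne (density P1 P0 x) = c}) ->
  betting PP0 B -> (0 < t)%N -> Lambda_t PP1 B t < KL P0 P1.
Proof.
move=> nc hB t0; have [S S0 hS] := eventually_moment_ge1 t hB.
have b01 (s : R) : (0 <= s)%R -> (0 < (1 + s)^-1 <= 1)%R.
  move=> s0; have s1 : (0 < 1 + s)%R by rewrite ltr_wpDr.
  by rewrite invr_gt0 s1 invf_le1// lerDl.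
apply: (le_lt_trans _ (renyi_lt_KL hac (b01 _ S0) nc)).
apply: ge_ereal_sup => _ [s /= s0 <-].
have [Ss|sS] := leP S s; last first.
  apply: (le_trans (Lambda_ts_le_renyi hPP0 hPP1 hac hB s0 t0)).
  have /andP[b0 b1] := b01 _ S0; have /andP[b'0 b'1] := b01 _ s0.
  by rewrite lee_fin renyi_ninc// lef_pV2 ?posrE ?ltr_wpDr// lerD2l ltW.
apply: (@le_trans _ _ 0); last by rewrite lee_fin renyi_ge0// b01.
rewrite /Lambda_ts mule_ge0_le0 ?lee_fin// /neg_log_moment oppe_le0 lne_ge0.
exact: hS.
Qed.

End not_attained.

Theorem theorem4p25 (R : realType) (d : measure_display) (X : measurableType d)
    (P0 P1 : probability X R) (PP0 PP1 : probability (seq_space X) R)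
    (hPP0 : is_iid_law P0 PP0) (hPP1 : is_iid_law P1 PP1)
    (hac : P1 `<< P0) (hKL : KL P1 P0 < +oo) :
  [/\ (* the four quantities coincide *)
      forall t : nat, (0 < t)%N ->
        [/\ ereal_sup [set Lambda_t PP1 B t | B in betting PP0]
              = ereal_sup [set Lambda_t PP1 B t | B in betting_iid P0 PP0],
            ereal_sup [set Lambda_t PP1 B t | B in betting_iid P0 PP0]
              = ereal_sup [set Lambda P1 E | E in evariables P0]
          & ereal_sup [set Lambda P1 E | E in evariables P0] = KL P0 P1],
      (* approached along the family Rbeta, whose members are e-variables *)
      (forall beta : R, (0 < beta <= 1)%R -> evariables P0 (Rbeta P0 P1 beta))
      /\ (Lambda P1 (Rbeta P0 P1 beta) @[beta --> 0%R^'+] --> KL P0 P1),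
      (* not attained *)
      P0 `<< P1 -> KL P0 P1 < +oo ->
      ~ (exists c : \bar R, {ae P0, forall x, lne (density P1 P0 x) = c}) ->
      forall B, betting PP0 B -> forall t : nat, (0 < t)%N ->
        Lambda_t PP1 B t < KL P0 P1,
      (* error bounds *)
      forall B, betting PP0 B ->
      forall alpha : R, (0 < alpha < 1)%R -> forall t : nat, (0 < t)%N ->
        gammabar_t PP1 B t alpha <= gamma_t PP1 B t alpha
        /\ forall s : R, (0 <= s)%R ->
             gamma_t PP1 B t alpha
               <= expeR ((s * ln alpha^-1)%:E - t%:R%:E * Lambda_ts PP1 B t s)
    & forall B, betting PP0 B -> forall (s : R) (t : nat),
        (0 <= s)%R -> (0 < t)%N -> Lambda_ts PP1 B t s <= KL P0 P1].
Proof.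
have le_KL B t s : betting PP0 B -> (0 <= s)%R -> (0 < t)%N ->
    Lambda_ts PP1 B t s <= KL P0 P1 by exact: Lambda_ts_le_KL.
have image_iid t : (0 < t)%N ->
    [set Lambda_t PP1 B t | B in betting_iid P0 PP0] =
    [set Lambda P1 E | E in evariables P0].
  move=> t0; apply/seteqP; split => [_ [B [_ [E hE BE]] <-]|_ [E hE <-]].
    by exists E => //; exact/esym/(Lambda_t_iid hPP1 hac).
  exists (fun n (w : seq_space X) => E (w n)); last exact: (Lambda_t_iid hPP1 hac).
  by split; [exact: (evariable_betting hPP0)|exists E].
have sup_betting_le t : (0 < t)%N ->
    ereal_sup [set Lambda_t PP1 B t | B in betting PP0] <= KL P0 P1.
  move=> t0; apply: ge_ereal_sup => _ [B hB <-].
  by apply: ge_ereal_sup => _ [s s0 <-]; exact: le_KL.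
have sup_iid_le t : ereal_sup [set Lambda_t PP1 B t | B in betting_iid P0 PP0]
    <= ereal_sup [set Lambda_t PP1 B t | B in betting PP0].
  by apply: ereal_sup_le => _ [B [hB _] <-]; exists B.
have renyi_le b : (0 < b <= 1)%R ->
    (renyi P0 P1 b)%:E <= Lambda P1 (Rbeta P0 P1 b).
  move=> b01; have /andP[b0 b1] := b01.
  rewrite -(neg_log_moment_Rbeta hac b01); apply: ereal_sup_ubound.
  by exists ((1 - b) / b)%R => //=; rewrite divr_ge0 ?subr_ge0// ltW.
have le_sup b : (0 < b <= 1)%R ->
    Lambda P1 (Rbeta P0 P1 b) <= ereal_sup [set Lambda P1 E | E in evariables P0].
  move=> b01; apply: ereal_sup_ubound; exists (Rbeta P0 P1 b) => //.
  exact: Rbeta_evariable.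
have near01 : \forall b \near (0 : R)^'+, (0 < b <= 1)%R.
  near=> b; apply/andP; split; near: b; first exact: nbhs_right_gt.
  exact: nbhs_right_le.
have supE : ereal_sup [set Lambda P1 E | E in evariables P0] = KL P0 P1.
  apply/eqP; rewrite eq_le; apply/andP; split.
    (* The supremum over [evariables] does not involve [t], so the upper bound for a single [t],
       here 1, suffices. *)
    rewrite -(image_iid 1%N)//; apply: le_trans (sup_iid_le _) _.
    exact: sup_betting_le.
  apply: (cvge_le _ (cvg_renyi hac)); apply: filterS near01 => b b01.
  exact: le_trans (renyi_le b b01) (le_sup b b01).
split.
- move=> t t0; rewrite image_iid// supE; split=> //.
  apply/eqP; rewrite eq_le sup_betting_le//= -supE -(image_iid t)//.
- split; first by move=> b b01; exact: Rbeta_evariable.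
  (* [Lambda] at [Rbeta] is at least [renyi], its value at one [s], and at most the common
     supremum. *)
  apply: (squeeze_cvge _ (cvg_renyi hac) (cvg_cst (KL P0 P1))).
  apply: filterS near01 => b b01; rewrite renyi_le//= -supE; exact: le_sup.
- by move=> dom _ nc B hB t t0; exact: Lambda_t_lt_KL hB t0.
- move=> B hB alpha a01 t t0; split; first exact: (gammabar_le_gamma _ hB).
  by move=> s s0; exact: (gamma_le_expeR _ hB).
- by move=> B hB s t s0 t0; exact: le_KL.
Unshelve. all: by end_near.
Qed.
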